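(* For each of the proximate neighbors problem (in the CREW atomic PEM model), the semigroup evaluation problem (in the CREW semigroup PEM model), and the atomic edge contraction problem (in the CREW edge-contracting PEM model), with $P\leq\frac{N}{B}$ processors, there exists at least one instance of size $N$ that requires at least $\Omega(\mathrm{perm}_P(N,M,B)+\log P)$ expected parallel I/Os by any randomized algorithm.
   Context: The PEM model has $P$ processors, each with a private cache of $M$ cells, and a shared memory partitioned into blocks of $B$ contiguous cells; in one parallel I/O each processor may read or write at most one block between shared memory and its cache; CREW means concurrent reads allowed, exclusive writes; cost is the number of parallel I/Os. Atomic PEM: every input element is an indivisible atom occupying one cell and revealing no information; operations are I/Os, copying and deleting atoms. Semigroup PEM: atomic PEM plus the operation creating a new atom $z=x\cdot y$ from atoms $x,y$ in one cache. Edge-contracting PEM: atomic PEM plus the operation replacing two atoms (in one cache) representing edges $(a,b),(b,c)$ by one atom representing $(a,c)$. Proximate neighbors problem of size $N$: atoms $x_i$, $i\in[N]$, with a labeling $\lambda:[N]\to[\frac N2]$, $|\lambda^{-1}(i)|=2$; solved by a shared-memory content in which, for every $i$, the two atoms labeled $i$ lie in the same block. Semigroup evaluation of size $N$: for a semigroup $(S,\cdot)$, input atoms $x_1,\dots,x_N\in S$ and a permutation $\pi$ of $[N]$, compute $\prod_{i=1}^N x_{\pi(i)}$; algorithms must be correct for every input and every semigroup. Atomic edge contraction of size $N$: atoms $x_1,\dots,x_N$ in arbitrary shared-memory locations representing the directed edges of an $(N+1)$-vertex path from $s$ to $t$; solved when an atom representing $(s,t)$ is written to shared memory. Notation: $\overline{\log}(x)=\max\{1,\log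 x\}$, $d=\max\{2,\min\{\frac{M}{B},\frac{N}{PB}\}\}$, $\mathrm{perm}_P(N,M,B)=\min\left\{\frac{N}{P},\ \frac{N}{PB}\,\overline{\log}_d\frac{N}{B}\right\}$.
   Formalization: For proximate neighbors (N even, N > B; N = B costs 0) the claim fails if the algorithm may know the labeling (B=2, M=4, P=N/2: 3 I/Os). So log P is capped at N/P there; the full bound is for algorithms not told the labeling, with the instance depending on the algorithm. *)

(* Defs.v *)
(* MathComp / MathComp-Analysis. *)
From HB Require Import structures.
From mathcomp Require Import all_boot all_order all_algebra all_fingroup.
From mathcomp Require Import all_classical all_reals all_analysis.

Set Implicit Arguments.
Unset Strict Implicit.
Unset Printing Implicit Defensive.

Import Order.TTheory GRing.Theory Num.Theory.
Local Open Scope ring_scope.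

(** * Parallel external memory with P processors, caches of M cells, blocks of
    B cells, and unboundedly many blocks of shared memory.  A cell holds at
    most one atom, of type [A]. *)

Definition cache_content (A : Type) (M : nat) := {ffun 'I_M -> option A}.
Definition block_content (A : Type) (B : nat) := {ffun 'I_B -> option A}.

Record config (A : Type) (P M B : nat) := Config {
  shared : nat -> block_content A B;
  cache : 'I_P -> cache_content A M }.

(* [E] is the type of the operations that a variant of the model adds to
   copying and deleting atoms. *)
Inductive local_op (E : Type) (M : nat) : Type :=
  | Copy (src dst : 'I_M)
  | Delete (i : 'I_M)
  | Extra (e : E).

(* [Read b g] loads into every cache cell [i] with [g i = Some k] the cell [k]
   of block [b] and leaves the other cache cells alone.  [Write b g] overwrites
   the whole block [b]: its cell [k] receives the cache cell [i] if
   [g k = Some i] and becomes empty if [g k = None]. *)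
Inductive io (M B : nat) : Type :=
  | Idle
  | Read (b : nat) (g : {ffun 'I_M -> option 'I_B})
  | Write (b : nat) (g : {ffun 'I_B -> option 'I_M}).

Arguments Idle {M B}.

(* One parallel I/O: every processor first performs finitely many operations in
   its own cache, which are free, and then at most one I/O. *)
Definition round (E : Type) (P M B : nat) :=
  {ffun 'I_P -> seq (local_op E M) * io M B}.

Definition idle_round (E : Type) (P M B : nat) : round E P M B :=
  [ffun=> ([::], Idle)].

(* The cost of a program is its [size]. *)
Definition program (E : Type) (P M B : nat) := seq (round E P M B).

Definition written (M B : nat) (b : nat) (a : io M B) :
    option {ffun 'I_B -> option 'I_M} :=
  if a is Write b' g then (if b' == b then Some g else None) else None.

(* Concurrent reads are unrestricted, writes are exclusive. *)
Definition crew_round (E : Type) (P M B : nat) (r : round E P M B) : Prop :=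
  forall (p q : 'I_P) (b : nat),
    written b (r p).2 -> written b (r q).2 -> p = q.

Definition crew (E : Type) (P M B : nat) (pr : program E P M B) : Prop :=
  forall t : nat, (t < size pr)%N ->
    crew_round (nth (idle_round E P M B) pr t).

Definition set_cell (A : Type) (M : nat) (c : cache_content A M) (i : 'I_M)
    (v : option A) : cache_content A M :=
  [ffun j => if j == i then v else c j].

Definition run_local (A E : Type) (M : nat)
    (sem : E -> cache_content A M -> cache_content A M)
    (c : cache_content A M) (o : local_op E M) : cache_content A M :=
  match o with
  | Copy i j => set_cell c j (c i)
  | Delete i => set_cell c i None
  | Extra e => sem e c
  end.

(* All reads of a round see the shared memory as it was before the round.  In a
   round satisfying [crew_round] the [pick] below has at most one candidate. *)
Definition run_round (A E : Type) (P M B : nat)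
    (sem : E -> cache_content A M -> cache_content A M)
    (cf : config A P M B) (r : round E P M B) : config A P M B :=
  let ca p := foldl (run_local sem) (cache cf p) (r p).1 in
  Config
    (fun b =>
       if [pick p | written b (r p).2 : bool] is Some p then
         if written b (r p).2 is Some g then
           [ffun k => if g k is Some i then ca p i else None]
         else shared cf b
       else shared cf b)
    (fun p =>
       if (r p).2 is Read b g then
         [ffun i => if g i is Some k then shared cf b k else ca p i]
       else ca p).

Definition run (A E : Type) (P M B : nat)
    (sem : E -> cache_content A M -> cache_content A M)
    (cf : config A P M B) (pr : program E P M B) : config A P M B :=
  foldl (run_round sem) cf pr.

(* Cell [i < N] of the shared memory holds [x i]; everything else is empty. *)
Definition initial (A : Type) (P M B N : nat) (x : 'I_N -> A) :
    config A P M B :=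
  Config (fun b => [ffun k : 'I_B => omap x (insub (b * B + k)%N)])
         (fun=> [ffun=> None]).

(** ** The three variants *)

Definition atomic_sem (A : Type) (M : nat) (e : void)
    (c : cache_content A M) : cache_content A M :=
  match e with end.

(* [(i, j, k)]: put the product of the atoms in cells [i] and [j] in cell [k]. *)
Definition semigroup_op (M : nat) : Type := ('I_M * 'I_M * 'I_M)%type.

Definition semigroup_sem (S : semigroupType) (M : nat) (e : semigroup_op M)
    (c : cache_content S M) : cache_content S M :=
  let: (i, j, k) := e in
  match c i, c j with
  | Some x, Some y => set_cell c k (Some (x * y)%g)
  | _, _ => c
  end.

(* An edge is the pair of its end points.  [(i, j)]: if cells [i] and [j] hold
   edges (u,v) and (v,w), replace them by (u,w), stored in cell [i]. *)
Definition edge_op (M : nat) : Type := ('I_M * 'I_M)%type.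

Definition edge_sem (M : nat) (e : edge_op M)
    (c : cache_content (nat * nat) M) : cache_content (nat * nat) M :=
  let: (i, j) := e in
  match c i, c j with
  | Some (u, v), Some (v', w) =>
      if v == v' then set_cell (set_cell c j None) i (Some (u, w)) else c
  | _, _ => c
  end.

(** ** Proximate neighbors *)

Definition labeling (N : nat) : Type :=
  {l : {ffun 'I_N -> 'I_N./2} | [forall a, #|[set i | l i == a]| == 2]}.

Definition label (N : nat) (l : labeling N) (i : 'I_N) : 'I_N./2 := val l i.

(* The atom x_i is represented by its name [i]. *)
Definition run_atomic (P M B N : nat) (pr : program void P M B) :
    config 'I_N P M B :=
  run (@atomic_sem 'I_N M) (initial P M B id) pr.

Definition solves_proximate (P M B N : nat) (l : labeling N)
    (pr : program void P M B) : Prop :=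
  crew pr /\
  forall a : 'I_N./2, exists b : nat, forall i : 'I_N, label l i = a ->
    exists k : 'I_B, shared (run_atomic N pr) b k = Some i.

(* What can be observed about the labeling [l] in a configuration: which atoms
   residing in the same cache carry equal labels. *)
Definition same_view (P M B N : nat) (l1 : labeling N) (c1 : config 'I_N P M B)
    (l2 : labeling N) (c2 : config 'I_N P M B) : Prop :=
  forall p : 'I_P, cache c1 p = cache c2 p /\
    forall (s t : 'I_M) (i j : 'I_N),
      cache c1 p s = Some i -> cache c1 p t = Some j ->
      (label l1 i == label l1 j) = (label l2 i == label l2 j).

(* [A l] is the course of a deterministic algorithm on the labeling [l].  Atoms
   are opaque, so this course may depend on [l] only through the views met so
   far.  Each processor's action may use the views of all processors: there is
   unrestricted free communication besides the exchange of atoms. *)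
Definition blind (P M B N : nat) (A : labeling N -> program void P M B) : Prop :=
  forall (l1 l2 : labeling N) (t : nat),
    (forall s : nat, (s <= t)%N ->
       same_view l1 (run_atomic N (take s (A l1)))
                 l2 (run_atomic N (take s (A l2)))) ->
    nth (idle_round void P M B) (A l1) t = nth (idle_round void P M B) (A l2) t.

(** ** Semigroup evaluation *)

(* A semigroup has no unit, hence no value for the empty product. *)
Definition sg_prod (S : semigroupType) (s : seq S) : option S :=
  if s is x :: s' then Some (foldl (fun y z => (y * z)%g) x s') else None.

(* The program does not depend on the semigroup or on the atoms. *)
Definition solves_semigroup (P M B N : nat) (pi : {perm 'I_N})
    (S : semigroupType) (x : 'I_N -> S) (pr : program (semigroup_op M) P M B) :
    Prop :=
  crew pr /\
  exists (b : nat) (k : 'I_B), exists2 z : S,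
    shared (run (@semigroup_sem S M) (initial P M B x) pr) b k = Some z &
    sg_prod [seq x (pi i) | i <- enum 'I_N] = Some z.

(** ** Atomic edge contraction *)

(* The path is 0 -> 1 -> ... -> N, with s = 0 and t = N; cell [i] of the shared
   memory initially holds its [sigma i]-th edge. *)
Definition path_edge (N : nat) (sigma : {perm 'I_N}) (i : 'I_N) : nat * nat :=
  (nat_of_ord (sigma i), (nat_of_ord (sigma i)).+1).

Definition solves_edges (P M B N : nat) (sigma : {perm 'I_N})
    (pr : program (edge_op M) P M B) : Prop :=
  crew pr /\
  exists (b : nat) (k : 'I_B),
    shared (run (@edge_sem M) (initial P M B (path_edge sigma)) pr) b k
      = Some (0%N, N).

(** ** Randomized algorithms and the bound *)

(* A random element of a type [T] of deterministic algorithms. *)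
Record randomized (R : realType) (T : Type) := Randomized {
  seed_display : measure_display;
  seed : measurableType seed_display;
  seed_prob : probability seed R;
  choice_of : seed -> T }.

Definition almost_surely (R : realType) (T : Type) (A : randomized R T)
    (Q : T -> Prop) : Prop :=
  \forall w \ae seed_prob A, Q (choice_of w).

Definition cost_measurable (R : realType) (T : Type) (A : randomized R T)
    (cost : T -> nat) : Prop :=
  measurable_fun setT (fun w : seed A => (cost (choice_of w))%:R : R).

Definition expected (R : realType) (T : Type) (A : randomized R T)
    (cost : T -> nat) : \bar R :=
  'E_(seed_prob A)[fun w => (cost (choice_of w))%:R].

Definition log2 (R : realType) (x : R) : R := ln x / ln 2.

(* max {1, log_b x} *)
Definition olog (R : realType) (b x : R) : R := Num.max 1 (ln x / ln b).

Definition perm_bound (R : realType) (P N M B : nat) : R :=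
  let n : R := N%:R in let m : R := M%:R in
  let p : R := P%:R in let b : R := B%:R in
  let d := Num.max 2 (Num.min (m / b) (n / (p * b))) in
  Num.min (n / p) (n / (p * b) * olog d (n / b)).

(* Main.v *)
(* All three problems reduce to moving one token per input cell: after deleting
   useless copies, a run gives every token a trajectory through blocks and
   caches, traced backwards from the output, along which the tokens at positions
   2a and 2a+1 of the hidden permutation eventually meet.  A token is forgotten
   once it has met its partner, so that an atom standing for an interval of
   positions carries at most two live tokens and a block at most 2B.

   Counting: given the live part of the state, a round is described by one block
   and a subset of its 2B live tokens per processor (the reads), the set of
   tokens written, and the set of tokens that meet their partners.  A set of the
   last two kinds takes at most 4B tokens from each cache, which leaves at most
   (e d)^(4PB) choices, once through the sizes of the caches and once through
   the total number of tokens.  The pairs are recovered from N/2 tokens and the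
   ranks, below 4B, of their partners among the tokens dying at the same place.
   Comparing with N! >= (N/e)^N yields the term perm_P(N,M,B).

   The term log P comes from the fact that the number of tokens in one place at
   most doubles in a round, while it must grow from B to N >= PB.  For proximate
   neighbors this term matters only if N/P < log P; then a blind algorithm is
   determined by one entry per pair, telling which two reads brought the pair
   into one cache, and in log P rounds there are too few entries for half of
   the N! permutations. *)
Require Import Defs.
From HB Require Import structures.
From mathcomp Require Import all_boot all_order all_algebra all_fingroup.
From mathcomp Require Import all_classical all_reals all_analysis.
From mathcomp Require Import zify ring lra.

Set Implicit Arguments.
Unset Strict Implicit.
Unset Printing Implicit Defensive.

Import Order.TTheory GRing.Theory Num.Theory.
Local Open Scope ring_scope.

(** * Coding subsets of a group by ranks, and sets of bounded size *)

Section RankCodes.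
Local Open Scope nat_scope.
Variable T : finType.

(** Ranks in [enum G] replace names, so the number of codes depends on the bound n for the group and
    not on the size of [T]. *)
Definition rank_code (n : nat) (G X : {set T}) : {set 'I_n} :=
  [set k : 'I_n | [exists i in X, index i (enum G) == k]].

Lemma rank_code_inj (n : nat) (G X Y : {set T}) :
  #|G| <= n -> X \subset G -> Y \subset G ->
  rank_code n G X = rank_code n G Y -> X = Y.
Proof.
move=> Gn.
suff sub (X' Y' : {set T}) : X' \subset G -> Y' \subset G ->
    rank_code n G X' = rank_code n G Y' -> X' \subset Y'.
  by move=> XG YG E; apply/eqP; rewrite finset.eqEsubset; apply/andP; split; exact: sub.
move=> XG YG E; apply/fintype.subsetP => i iX.
have iG : i \in enum G by rewrite mem_enum (fintype.subsetP XG).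
have ilt : index i (enum G) < n.
  by apply: leq_trans Gn; rewrite cardE index_mem.
have : Ordinal ilt \in rank_code n G X'.
  by rewrite inE; apply/exists_inP; exists i.
rewrite E inE => /exists_inP[j jY /eqP /= Eij].
have jG : j \in enum G by rewrite mem_enum (fintype.subsetP YG).
by rewrite -(nth_index i iG) -Eij nth_index.
Qed.

Lemma card_rank_code (n : nat) (G X : {set T}) : #|rank_code n G X| <= #|X|.
Proof.
rewrite cardE -(size_map val) (cardE X) -(size_map (index^~ (enum G))).
apply: uniq_leq_size => [|k].
  by rewrite map_inj_uniq ?enum_uniq //; exact: val_inj.
case/mapP => j; rewrite mem_enum inE => /exists_inP[i iX /eqP Ei] ->.
by apply/mapP; exists i; rewrite ?mem_enum.
Qed.

Definition small_set (k : nat) : Type := {X : {set T} | #|X| <= k}.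
HB.instance Definition _ k := SubType.copy (small_set k) {X : {set T} | #|X| <= k}.
HB.instance Definition _ k := Finite.copy (small_set k) {X : {set T} | #|X| <= k}.

Fact card_set0_leq k : #|@finset.set0 T| <= k.
Proof. by rewrite cards0. Qed.

(** Oversized sets fall back to the empty set, so the code is faithful only below the bound. *)
Definition to_small (k : nat) (X : {set T}) : small_set k :=
  insubd (Sub finset.set0 (card_set0_leq k) : small_set k) X.

Lemma to_smallK (k : nat) (X : {set T}) : #|X| <= k -> val (to_small k X) = X.
Proof. by move=> Xk; rewrite val_insubd Xk. Qed.

End RankCodes.

(** * Token schedules *)

Section Schedules.
Local Open Scope nat_scope.
Variables N M B P : nat.

(** [inl] stands for a block of shared memory, [inr] for a cache. *)
Definition place : Type := (nat + 'I_P)%type.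

(* Without a partner, as for the last position when [N] is odd, [q] is its own
   partner and its token is never live. *)
Definition partner (q : 'I_N) : 'I_N :=
  insubd q (if odd q then q.-1 else q.+1).

Lemma partnerK : involutive partner.
Proof.
move=> q; apply: val_inj; rewrite !val_insubd.
case: (boolP (odd q)) => oq /=.
  have ltq : q.-1 < N by rewrite (leq_ltn_trans (leq_pred _)).
  rewrite ltq /=; have -> : odd q.-1 = false by lia.
  by rewrite prednK ?ltn_ord //; lia.
case: (ltnP q.+1 N) => ltq /=; first by rewrite oq /= ltn_ord.
by rewrite (negPf oq) ltnNge ltq.
Qed.

(** Tokens are named by input cells and partners are defined on positions, hence the conjugation by
    [pi]. *)
Definition mate (pi : {perm 'I_N}) (i : 'I_N) : 'I_N :=
  pi (partner ((pi^-1)%g i)).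

Lemma mateK pi : involutive (mate pi).
Proof. by move=> i; rewrite /mate permK partnerK permKV. Qed.

(** A write replaces the whole block, so a token can rest in a block only if nobody writes there. *)
Definition legal_move (rd wr : 'I_P -> option nat) (x y : place) : Prop :=
  match x, y with
  | inl b, inl b' => b = b' /\ forall p, wr p <> Some b
  | inl b, inr p => rd p = Some b
  | inr p, inl b => wr p = Some b
  | inr p, inr q => p = q
  end.

(** The factor 2: an atom stands for an interval of positions, and at most its first and last ones
    can have partners outside it. *)
Definition capacity (y : place) : nat := if y is inl _ then 2 * B else 2 * M.

(* Token [i] starts in cell [i] of the input and [pi] maps positions to cells. *)
Record schedule (pi : {perm 'I_N}) (T : nat) := Schedule {
  loc : nat -> 'I_N -> place;
  rd : nat -> 'I_P -> option nat;
  wr : nat -> 'I_P -> option nat;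
  loc0 : forall i, loc 0 i = inl (i %/ B);
  wr_excl : forall t p q b, wr t p = Some b -> wr t q = Some b -> p = q;
  loc_move : forall t i, t < T -> legal_move (rd t) (wr t) (loc t i) (loc t.+1 i);
  loc_capacity : forall t y, t <= T ->
    #|[set i | (loc t i == y) && (loc t (mate pi i) != y)]| <= capacity y;
  loc_end : forall i, loc T i = loc T (mate pi i) }.

Section One.
Variables (pi : {perm 'I_N}) (T : nat) (S : schedule pi T).

(** The whole history is consulted because partners may separate after meeting; the pair then
    remains forgotten. *)
Fixpoint live (t : nat) (i : 'I_N) : bool :=
  (if t is s.+1 then live s i else true) && (loc S t i != loc S t (mate pi i)).

(** Everything counts as live before time 0, so that partners sharing an input block die at time
    0. *)
Definition live_before (t : nat) (i : 'I_N) : bool :=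
  if t is s.+1 then live s i else true.

Definition in_cache (t : nat) (i : 'I_N) : option 'I_P :=
  if loc S t i is inr p then Some p else None.

Definition together (t : nat) (i j : 'I_N) : bool := loc S t i == loc S t j.

Lemma liveE t i :
  live t i = live_before t i && (loc S t i != loc S t (mate pi i)).
Proof. by case: t. Qed.

Lemma live_apart t i : live t i -> loc S t i != loc S t (mate pi i).
Proof. by rewrite liveE => /andP[]. Qed.

Lemma live_mate t i : live t (mate pi i) = live t i.
Proof.
by elim: t => [|t IH] /=; rewrite mateK eq_sym ?IH.
Qed.

Lemma live_before_mate t i : live_before t (mate pi i) = live_before t i.
Proof. by case: t => //= t; rewrite live_mate. Qed.

Lemma live_le s t i : s <= t -> live t i -> live s i.
Proof.
elim: t => [|t IH]; first by rewrite leqn0 => /eqP ->.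
by rewrite leq_eqVlt => /predU1P[-> //|/IH {}IH] /= /andP[/IH].
Qed.

Lemma card_live t y : t <= T ->
  #|[set i | live t i && (loc S t i == y)]| <= capacity y.
Proof.
move=> /(loc_capacity S y); apply: leq_trans; apply: subset_leq_card.
apply/fintype.subsetP => i; rewrite !inE => /andP[/live_apart ap /eqP Ei].
by rewrite -Ei eqxx eq_sym.
Qed.

Lemma in_cacheP t i p : (in_cache t i == Some p) = (loc S t i == inr p).
Proof. by rewrite /in_cache; case: (loc S t i). Qed.

(** Two tokens in blocks after the round either both rested, or both were written, and by exclusive
    writing share a block exactly if they left the same cache. A written block retains no resting
    token. Block numbers are thus dispensable. *)
Lemma together_step t i j : t < T ->
  together t.+1 i j =
  match in_cache t.+1 i, in_cache t.+1 j with
  | Some p, Some q => p == q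
  | None, None => match in_cache t i, in_cache t j with
                  | None, None => together t i j
                  | Some p, Some q => p == q
                  | _, _ => false
                  end
  | _, _ => false
  end.
Proof.
move=> tT; have := loc_move S i tT; have := loc_move S j tT.
rewrite /together /in_cache /legal_move.
case: (loc S t.+1 i) => [b|p]; case: (loc S t.+1 j) => [c|q] //;
  case: (loc S t i) => [b'|p']; case: (loc S t j) => [c'|q'] //.
- by move=> [-> _] [-> _].
- move=> Hq [Eb Hw]; apply/eqP => -[Ebc]; apply: (Hw q').
  by rewrite Eb Ebc.
- move=> [Eb Hw] Hq; apply/eqP => -[Ebc]; apply: (Hw p').
  by rewrite Eb -Ebc.
move=> Hq Hp; apply/eqP/eqP => [[Ebc]|Epq].
  by rewrite Ebc in Hp; exact: wr_excl Hp Hq.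
by move: Hp; rewrite Epq Hq => -[->].
Qed.

Definition loaded (t : nat) (p : 'I_P) : {set 'I_N} :=
  [set i | [&& live t i, ~~ in_cache t i & in_cache t.+1 i == Some p]].

Definition stored (t : nat) : {set 'I_N} :=
  [set i | [&& live t i, isSome (in_cache t i) & ~~ in_cache t.+1 i]].

Definition dying (t : nat) : {set 'I_N} :=
  [set i | live t i && ~~ live t.+1 i].

(** Not the partners: these are the live tokens in the same place as [j], the ground set in which a
    read is ranked. *)
Definition mates (t : nat) (j : 'I_N) : {set 'I_N} :=
  [set i | live t i && together t i j].

(** A processor reads one block per round, so a single loaded token identifies the common source of
    all. *)
Lemma loaded_mates t p j : t < T -> j \in loaded t p ->
  loaded t p \subset mates t j.
Proof.
move=> tT; rewrite inE => /and3P[_ cj cj']; apply/fintype.subsetP => i.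
rewrite !inE => /and3P[-> ci ci'] /=; move: cj cj' ci ci'.
have := loc_move S i tT; have := loc_move S j tT.
rewrite /together /in_cache /legal_move.
case: (loc S t.+1 i) => [b|q]; case: (loc S t.+1 j) => [c|q'] //;
  case: (loc S t i) => [b'|p']; case: (loc S t j) => [c'|p''] //.
by move=> Hj Hi _ /eqP[Ej] _ /eqP[Ei]; subst; move: Hj; rewrite Hi => -[->].
Qed.

Lemma card_mates t p j : t < T -> j \in loaded t p -> #|mates t j| <= 2 * B.
Proof.
move=> tT; rewrite inE => /and3P[_ cj _].
have := card_live (loc S t j) (ltnW tT); move: cj.
rewrite /in_cache; case E: (loc S t j) => [b|//] _ /=; apply: leq_trans.
by apply/subset_leq_card/fintype.subsetP => i; rewrite !inE /together E.
Qed.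

Lemma card_loaded t p : t < T -> #|loaded t p| <= 2 * B.
Proof.
move=> tT; case: (set_0Vmem (loaded t p)) => [->|[j jl]]; first by rewrite cards0.
exact: leq_trans (subset_leq_card (loaded_mates tT jl)) (card_mates tT jl).
Qed.

(** Tokens that share a block after a round shared a block or a cache before it, by [together_step];
    so partners can first meet only in a cache. *)
Lemma dying_cached t i : t < T -> i \in dying t -> isSome (in_cache t.+1 i).
Proof.
move=> tT; rewrite inE /= negb_and negbK => /andP[li].
rewrite li /= => tog; have := together_step i (mate pi i) tT.
rewrite {1}/together tog; case: (in_cache t.+1 i) => //.
case: (in_cache t.+1 _) => //.
have ap := live_apart li; rewrite /together (negPf ap) /in_cache; move: ap.
case: (loc S t i) => [b|p]; case: (loc S t (mate pi i)) => [c|q] //=.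
by move=> h /esym/eqP E; move: h; rewrite E eqxx.
Qed.

(** When partners meet in a cache one of them has just been read, since otherwise they were both
    there already. The dying tokens are thus loaded tokens or mates of such, twice 2 * B. *)
Lemma card_dying t p : t < T ->
  #|[set i in dying t | in_cache t.+1 i == Some p]| <= 4 * B.
Proof.
move=> tT; set X := [set i in _ | _].
have sub : X \subset loaded t p :|: [set mate pi i | i in loaded t p].
  apply/fintype.subsetP => i; rewrite !inE /= negb_and negbK.
  case/andP => /andP[li]; rewrite li /= => tog ci'.
  have cm' : in_cache t.+1 (mate pi i) == Some p.
    by rewrite in_cacheP -(eqP tog) -in_cacheP.
  case ci: (in_cache t i) => [q|] /=; last by rewrite ci'.
  apply/imsetP; exists (mate pi i); last by rewrite mateK.
  rewrite inE live_mate li cm' andbT /=; apply/negP => cm.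
  case/negP: (live_apart li); move: ci cm cm' ci'.
  have := loc_move S i tT; have := loc_move S (mate pi i) tT.
  rewrite /in_cache /legal_move.
  case: (loc S t i) => [b|q']; case: (loc S t (mate pi i)) => [c|q''] //.
  case: (loc S t.+1 i) => [b'|r] //; case: (loc S t.+1 _) => [c'|r'] //.
  by move=> -> -> _ _ /eqP[->] /eqP[->].
apply: leq_trans (subset_leq_card sub) _; rewrite cardsU.
apply: leq_trans (leq_subr _ _) _.
have -> : 4 * B = 2 * B + 2 * B by rewrite -mulnDl.
apply: leq_add (card_loaded p tT) _.
exact: leq_trans (leq_imset_card _ _) (card_loaded p tT).
Qed.

(** Stored tokens stay live by [dying_cached] and all land in the one block written, so even 2 * B
    bounds them; 4 * B matches [card_dying]. *)
Lemma card_stored t p : t < T ->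
  #|[set i in stored t | in_cache t i == Some p]| <= 4 * B.
Proof.
move=> tT; set X := [set i in _ | _].
case: (set_0Vmem X) => [->|[j]]; first by rewrite cards0.
rewrite !inE => /andP[/and3P[lj _ nj] cj].
apply: leq_trans (_ : 2 * B <= _); last by rewrite leq_mul2r orbT.
apply: leq_trans (_ : #|[set i | live t.+1 i && (loc S t.+1 i == loc S t.+1 j)]| <= _).
  apply/subset_leq_card/fintype.subsetP => i; rewrite !inE.
  case/andP => /and3P[li _ ni] ci; apply/andP; split.
    apply/negPn/negP => di.
    have : i \in dying t by rewrite inE li di.
    by move/(dying_cached tT); rewrite (negPf ni).
  move: ci cj ni nj; have := loc_move S i tT; have := loc_move S j tT.
  rewrite /in_cache /legal_move.
  case: (loc S t.+1 i) => [b|q]; case: (loc S t.+1 j) => [c|q'] //;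
    case: (loc S t i) => [b'|p']; case: (loc S t j) => [c'|p''] //.
  by move=> Hj Hi /eqP[Ei] /eqP[Ej]; subst; move: Hj; rewrite Hi => -[->].
have := card_live (loc S t.+1 j) tT; move: nj.
by rewrite /in_cache; case: (loc S t.+1 j).
Qed.

Definition cached (t : nat) : {ffun 'I_N -> option 'I_P} :=
  [ffun i => if live t i then in_cache t i else None].

Definition cached_next (t : nat) : {ffun 'I_N -> option 'I_P} :=
  [ffun i => if live t i then in_cache t.+1 i else None].

(** Common shape of [stored], sorted by the cache before the round, and [dying], sorted by the cache
    after it, so that one encoding serves both. *)
Definition admissible (C : {ffun 'I_N -> option 'I_P}) (X : {set 'I_N}) : Prop :=
  [/\ forall i, i \in X -> isSome (C i),
      forall p, #|[set i | C i == Some p]| <= 2 * M + 2 * B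
    & forall p, #|[set i in X | C i == Some p]| <= 4 * B].

Lemma card_cached t p : t < T ->
  #|[set i | live t i && (in_cache t i == Some p)]| <= 2 * M.
Proof.
move=> tT; apply: leq_trans (card_live (inr p) (ltnW tT)).
by apply/subset_leq_card/fintype.subsetP => i; rewrite !inE in_cacheP.
Qed.

Lemma admissible_stored t : t < T -> admissible (cached t) (stored t).
Proof.
move=> tT; split=> [i|p|p].
- by rewrite inE ffunE => /and3P[->].
- apply: leq_trans (leq_addr _ _); apply: leq_trans (card_cached p tT).
  apply/subset_leq_card/fintype.subsetP => i; rewrite !inE ffunE.
  by case: (live t i).
apply: leq_trans (card_stored p tT).
apply/subset_leq_card/fintype.subsetP => i; rewrite !inE ffunE.
by case: (live t i).
Qed.

(** [cached_next] includes the tokens dying in this round, which the later capacity does not count;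
    they were held before (2 * M) or just loaded (2 * B). *)
Lemma admissible_dying t : t < T -> admissible (cached_next t) (dying t).
Proof.
move=> tT; split=> [i|p|p].
- move=> di; rewrite ffunE; move: (di); rewrite inE => /andP[-> _].
  exact: dying_cached di.
- apply: leq_trans (leq_add (card_cached p tT) (card_loaded p tT)).
  apply: leq_trans (leq_card_setU _ _).
  apply/subset_leq_card/fintype.subsetP => i; rewrite !inE ffunE.
  case: (live t i) => //= ci'; rewrite ci' andbT.
  move: (ci'); rewrite /in_cache; have := loc_move S i tT; rewrite /legal_move.
  by case: (loc S t.+1 i) => // q; case: (loc S t i) => [b|q'] //= -> ->.
apply: leq_trans (card_dying p tT).
apply/subset_leq_card/fintype.subsetP => i; rewrite !inE ffunE.
by case: (live t i).
Qed.

(* At most one round [t] qualifies, the one in which [u] meets its partner. *)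
Definition death_group (u : 'I_N) : {set 'I_N} :=
  [set i | [exists t : 'I_T.+1,
    [&& live_before t u, ~~ live t u, live_before t i, ~~ live t i
      & together t i u]]].

Lemma live_end i : ~~ live T i.
Proof. by rewrite liveE negb_and negbK (loc_end S i) eqxx orbT. Qed.

Lemma mate_death_group u : mate pi u \in death_group u.
Proof.
have [|t dt tmin] := ex_minnP (P := fun t => ~~ live t u); first by exists T; exact: live_end.
have tT : t < T.+1 by rewrite ltnS tmin ?live_end.
have lb : live_before t u.
  by case: t dt tmin tT => //= t _ tmin _; apply/negPn/negP => /tmin; rewrite ltnn.
rewrite inE; apply/existsP; exists (Ordinal tT) => /=.
rewrite live_mate live_before_mate dt lb /=.
by move: dt; rewrite liveE lb negbK /= /together eq_sym.
Qed.

(** A group dying at time 0 lies in one input block and has at most B tokens; a later one dies in a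
    single cache, where [card_dying] applies. *)
Lemma card_death_group u : 0 < B -> #|death_group u| <= 4 * B.
Proof.
move=> B0; case: (set_0Vmem (death_group u)) => [->|[j]]; first by rewrite cards0.
rewrite inE => /existsP[t /and5P[bu du _ _ _]].
have uniq_t (s : 'I_T.+1) : live_before s u -> ~~ live s u -> s = t :> nat.
  case: s t bu du => [[|s] hs] [[|t] ht] //= bu du bu' du'.
  - by case/negP: du'; exact: live_le (leq0n t) bu.
  - by case/negP: du; exact: live_le (leq0n s) bu'.
  congr _.+1; case: (ltngtP s t) => // st.
  - by case/negP: du'; exact: live_le st bu.
  - by case/negP: du; exact: live_le st bu'.
apply: leq_trans (_ : #|[set i | [&& live_before t i, ~~ live t i
      & together t i u]]| <= _).
  apply/subset_leq_card/fintype.subsetP => i; rewrite !inE.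
  by case/existsP => s /and5P[bs ds]; rewrite (uniq_t _ bs ds) => -> -> ->.
clear uniq_t; move: (nat_of_ord t) (ltn_ord t) bu du => {}t; case: t => [|t] tT bu du.
  apply: leq_trans (_ : B <= _); last by rewrite leq_pmull.
  have [f fP] : exists f : 'I_N -> 'I_B, forall i, val (f i) = i %% B.
    by exists (fun i => Ordinal (ltn_pmod i B0)).
  rewrite -[X in _ <= X]card_ord.
  apply: (@leq_card_in _ _ f) => i k; rewrite !inE /together !loc0.
  move=> /and3P[_ _ /eqP[Ei]] /and3P[_ _ /eqP[Ek]] /(congr1 val).
  by rewrite !fP => Em; apply: val_inj; rewrite /= (divn_eq i B) (divn_eq k B) Ei Ek Em.
have : u \in dying t by rewrite inE; move: bu du => /= -> ->.
move/(dying_cached tT); case cu: (in_cache t.+1 u) => [p|//] _.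
apply: leq_trans (card_dying p tT).
apply/subset_leq_card/fintype.subsetP => i; rewrite !inE => /and3P[/= -> -> tog].
by rewrite in_cacheP (eqP tog) -in_cacheP cu eqxx.
Qed.

End One.
End Schedules.

(** * Permutations as lists of pairs of positions *)

Section Pairs.
Local Open Scope nat_scope.
Variable N : nat.

Fact pair_fst_subproof (a : 'I_N./2) : a.*2 < N.
Proof. by have := ltn_ord a; lia. Qed.
Fact pair_snd_subproof (a : 'I_N./2) : a.*2.+1 < N.
Proof. by have := ltn_ord a; lia. Qed.
Definition pair_fst (a : 'I_N./2) : 'I_N := Ordinal (pair_fst_subproof a).
Definition pair_snd (a : 'I_N./2) : 'I_N := Ordinal (pair_snd_subproof a).

Lemma partner_fst a : partner (pair_fst a) = pair_snd a.
Proof.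
by apply: val_inj; rewrite val_insubd /= odd_double /= pair_snd_subproof.
Qed.

(** For odd N one position is unpaired, and a bijection has only one value left for it. *)
Lemma perm_eq_on_pairs (pi1 pi2 : {perm 'I_N}) :
  (forall a, pi1 (pair_fst a) = pi2 (pair_fst a)) ->
  (forall a, pi1 (pair_snd a) = pi2 (pair_snd a)) -> pi1 = pi2.
Proof.
move=> E1 E2.
have E (q : 'I_N) : q./2 < N./2 -> pi1 q = pi2 q.
  move=> h; have [oq|eq] := boolP (odd q).
    have -> : q = pair_snd (Ordinal h) by apply: val_inj => /=; lia.
    exact: E2.
  have -> : q = pair_fst (Ordinal h) by apply: val_inj => /=; lia.
  exact: E1.
apply/permP => q; have [/E //|hq] := ltnP q./2 N./2.
have [r Er] : exists r, pi1 r = pi2 q by exists ((pi1^-1)%g (pi2 q)); rewrite permKV.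
have [hr|hr] := ltnP r./2 N./2.
  by move: Er; rewrite (E r hr) => /perm_inj rq; move: hq; rewrite -rq leqNgt hr.
have -> : q = r by apply: val_inj => /=; have := ltn_ord q; have := ltn_ord r; lia.
rewrite Er; congr (pi2 _); apply: val_inj => /=.
by have := ltn_ord q; have := ltn_ord r; lia.
Qed.

End Pairs.

(** * Schedules determine few permutations *)

Section ScheduleCode.
Local Open Scope nat_scope.
Variables N M B P : nat.
Hypothesis B_gt0 : 0 < B.
Variable T : nat.
(** The encoding of stored and dying sets stays abstract; one based on all tokens and one working
    cache by cache are plugged in later. *)
Variables (K : finType)
  (enc : {ffun 'I_N -> option 'I_P} -> {set 'I_N} -> K).
Hypothesis enc_inj : forall C X Y, admissible M B C X -> admissible M B C Y ->
  enc C X = enc C Y -> X = Y.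

Section Code.
Variables (pi : {perm 'I_N}) (S : schedule M B P pi T).

Definition read_source (t : nat) (p : 'I_P) : option 'I_N :=
  [pick j in loaded S t p].

(* One loaded token names the block that is read, so block numbers, which are
   unbounded, need not be encoded. *)
Definition read_code (t : nat) (p : 'I_P) : option 'I_N * {set 'I_(2 * B)} :=
  (read_source t p,
   if read_source t p is Some j
   then rank_code (2 * B) (mates S t j) (loaded S t p) else finset.set0).

Definition round_code (t : nat) :
    {ffun 'I_P -> option 'I_N * {set 'I_(2 * B)}} * K * K :=
  ([ffun p => read_code t p], enc (cached S t) (stored S t),
   enc (cached_next S t) (dying S t)).

(** [insub] succeeds because a death group has at most 4 * B members; the option type accounts for
    (4 * B).+1 in the count. *)
Definition pair_code (a : 'I_N./2) : 'I_N * option 'I_(4 * B) :=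
  (pi (pair_fst a),
   insub (index (pi (pair_snd a)) (enum (death_group S (pi (pair_fst a)))))).

Definition code_type : finType :=
  ({set 'I_N} * {ffun 'I_N./2 -> 'I_N * option 'I_(4 * B)}
   * {ffun 'I_T -> {ffun 'I_P -> option 'I_N * {set 'I_(2 * B)}} * K * K})%type.

Definition schedule_code : code_type :=
  ([set i | live S 0 i], [ffun a => pair_code a], [ffun t : 'I_T => round_code t]).

Lemma pair_snd_death_group a :
  pi (pair_snd a) \in death_group S (pi (pair_fst a)).
Proof.
by have := mate_death_group S (pi (pair_fst a)); rewrite /mate permK partner_fst.
Qed.

End Code.

Section Injectivity.
Variables (pi1 pi2 : {perm 'I_N}).
Variables (S1 : schedule M B P pi1 T) (S2 : schedule M B P pi2 T).
Hypothesis eq_code : schedule_code S1 = schedule_code S2.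

(** What a decoder knows at time t about tokens not yet dead: their caches and which of them share a
    place, but no block numbers. *)
Definition agree (t : nat) : Prop :=
  [/\ live_before S1 t =1 live_before S2 t,
      forall i, live_before S1 t i -> in_cache S1 t i = in_cache S2 t i,
      forall i j, live_before S1 t i -> live_before S1 t j ->
        together S1 t i j = together S2 t i j
    & live S1 t =1 live S2 t].

Lemma agree0 : agree 0.
Proof.
split=> [//|i _|i j _ _|i].
- by rewrite /in_cache !loc0.
- by rewrite /together !loc0.
have := congr1 (fun c : code_type => i \in c.1.1) eq_code.
by rewrite !inE.
Qed.

Lemma eq_round_code t : t < T -> round_code S1 t = round_code S2 t.
Proof.
move=> tT; have := congr1 (fun c : code_type => c.2 (Ordinal tT)) eq_code.
by rewrite !ffunE.
Qed.

Lemma agree_loaded t p : t < T -> agree t -> loaded S1 t p = loaded S2 t p.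
Proof.
move=> tT [_ _ tog liv].
have [/ffunP/(_ p) + _ _] := eq_round_code tT.
rewrite !ffunE /read_code => -[Es].
have eqg j : j \in loaded S1 t p -> mates S1 t j = mates S2 t j.
  rewrite inE => /and3P[lj _ _]; apply/setP => i; rewrite !inE -liv.
  case li: (live S1 t i) => //=.
  by apply: tog; move: li lj; rewrite !liveE => /andP[] // _ _ /andP[].
move: Es; rewrite /read_source.
case: pickP => [j jl|no1]; case: pickP => [k kl|no2] //.
  move=> [Ejk]; subst k.
  rewrite (eqg j jl); apply: rank_code_inj.
  - by rewrite -(eqg j jl); apply: card_mates jl.
  - by rewrite -(eqg j jl); exact: loaded_mates.
  - exact: loaded_mates.
by move=> _ _; apply/setP => i; rewrite [LHS]no1 [RHS]no2.
Qed.

(** Decoding order: the loaded sets from the ranks, the stored set from the caches before the round,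
    hence the caches after it, then the dying set from these; [together_step] updates the rest. *)
Lemma agree_step t : t < T -> agree t -> agree t.+1.
Proof.
move=> tT ag; have [_ cac tog liv] := ag.
have lb i : live S1 t i -> live_before S1 t i by rewrite liveE => /andP[].
have eqC : cached S1 t = cached S2 t.
  apply/ffunP => i; rewrite !ffunE -liv; case li: (live S1 t i) => //.
  exact: cac (lb _ li).
have eqW : stored S1 t = stored S2 t.
  have [_ + _] := eq_round_code tT; rewrite -eqC.
  apply: enc_inj; first exact: admissible_stored.
  by rewrite eqC; exact: admissible_stored.
have eqN i : live S1 t i -> in_cache S1 t.+1 i = in_cache S2 t.+1 i.
  move=> li; have li2 : live S2 t i by rewrite -liv.
  case ci: (in_cache S1 t i) => [p|].
    have ci2 : in_cache S2 t i = Some p by rewrite -cac ?lb.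
    have := congr1 (fun X : {set 'I_N} => i \in X) eqW.
    rewrite !inE li li2 ci ci2 /=.
    move: ci ci2; rewrite /in_cache.
    have := loc_move S1 i tT; have := loc_move S2 i tT; rewrite /legal_move.
    case: (loc S1 t.+1 i) => [b|q]; case: (loc S2 t.+1 i) => [c|q'] //=.
    case: (loc S1 t i) => [b'|p'] //; case: (loc S2 t i) => [c'|p''] //.
    by move=> -> -> [->] [->].
  have ci2 : in_cache S2 t i = None by rewrite -cac ?lb.
  have H p : (in_cache S1 t.+1 i == Some p) = (in_cache S2 t.+1 i == Some p).
    have := congr1 (fun X : {set 'I_N} => i \in X) (agree_loaded p tT ag).
    by rewrite !inE li li2 ci ci2.
  case E1: (in_cache S1 t.+1 i) => [p|].
    by have := H p; rewrite E1 eqxx => /esym/eqP ->.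
  case E2: (in_cache S2 t.+1 i) => [p|//].
  by have := H p; rewrite E1 E2 eqxx.
have eqC' : cached_next S1 t = cached_next S2 t.
  apply/ffunP => i; rewrite !ffunE -liv; case li: (live S1 t i) => //.
  exact: eqN.
have eqD : dying S1 t = dying S2 t.
  have [_ _ +] := eq_round_code tT; rewrite -eqC'.
  apply: enc_inj; first exact: admissible_dying.
  by rewrite eqC'; exact: admissible_dying.
split=> // [i j /= li lj|i].
  rewrite !together_step // -!eqN //.
  by rewrite -!cac ?lb // tog ?lb.
have := congr1 (fun X : {set 'I_N} => i \in X) eqD.
rewrite !inE -liv; case li: (live S1 t i); first by move/negb_inj.
by rewrite /= -liv li.
Qed.

(** Agreement at all times makes the death groups equal, so equal ranks name equal partners. *)
Lemma schedule_code_inj : pi1 = pi2.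
Proof.
have ag t : t <= T -> agree t.
  elim: t => [|t IH] tT; first exact: agree0.
  by apply: agree_step => //; apply: IH; exact: ltnW.
have eqD u : death_group S1 u = death_group S2 u.
  apply/setP => i; rewrite !inE; apply: eq_existsb => t.
  have [lb _ tog liv] := ag t (ltn_ord t).
  rewrite -!lb -!liv; case b1: (live_before S1 t u) => //=.
  by case b2: (live_before S1 t i) => //=; rewrite tog.
have eqP a : pair_code S1 a = pair_code S2 a.
  by have := congr1 (fun c : code_type => c.1.2 a) eq_code; rewrite !ffunE.
have eq_fst a : pi1 (pair_fst a) = pi2 (pair_fst a) by have [] := eqP a.
apply: perm_eq_on_pairs => // a.
have [_] := eqP a; rewrite -eq_fst -eqD.
set G := death_group S1 _.
have G1 : pi1 (pair_snd a) \in enum G by rewrite mem_enum pair_snd_death_group.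
have G2 : pi2 (pair_snd a) \in enum G.
  by rewrite mem_enum /G eqD eq_fst pair_snd_death_group.
have lt i : i \in enum G -> index i (enum G) < 4 * B.
  by rewrite -index_mem -cardE => /leq_trans; apply; exact: card_death_group.
rewrite !insubT ?lt // => h1 h2 [E].
by rewrite -(nth_index (pi1 (pair_snd a)) G1) E nth_index.
Qed.

End Injectivity.

Lemma card_scheduled (F : {set {perm 'I_N}}) :
  (forall pi, pi \in F -> inhabited (schedule M B P pi T)) ->
  #|F| <= 2 ^ N * (N * (4 * B).+1) ^ N./2
          * ((N.+1 * 2 ^ (2 * B)) ^ P * #|K| * #|K|) ^ T.
Proof.
move=> FS.
have [-> |[pi0 /[dup] F0 /FS[S0]]] := set_0Vmem F; first by rewrite cards0.
have [f fP] : {f : {perm 'I_N} -> code_type & forall pi, pi \in F ->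
    exists S : schedule M B P pi T, f pi = schedule_code S}.
  apply: (@choice _ _ (fun pi c => pi \in F ->
    exists S : schedule M B P pi T, c = schedule_code S)) => pi.
  have [/FS[S]|nF] := boolP (pi \in F); first by exists (schedule_code S); exists S.
  by exists (schedule_code S0).
have f_inj : {in F &, injective f}.
  by move=> pi1 pi2 /fP[S1 ->] /fP[S2 ->]; exact: schedule_code_inj.
apply: leq_trans (_ : #|code_type| <= _).
  by rewrite -(card_in_imset f_inj) max_card.
rewrite !card_prod !card_ffun !card_prod !card_ffun !card_prod !card_option !card_ord.
have cs n : #|{set 'I_n}| = 2 ^ n by rewrite -cardsT -powersetT card_powerset cardsT card_ord.
by rewrite !cs.
Qed.

End ScheduleCode.

(** * Two encodings of admissible sets *)

Section Selectors.
Local Open Scope nat_scope.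
Variables N M B P : nat.

(** Costs about P B log(N/(P B)), which is the cheaper choice when caches are large. *)
Definition direct_code (C : {ffun 'I_N -> option 'I_P}) (X : {set 'I_N}) :
    small_set 'I_N (P * (4 * B)) :=
  to_small (P * (4 * B)) X.

Lemma direct_code_inj (C : {ffun 'I_N -> option 'I_P}) (X Y : {set 'I_N}) :
  admissible M B C X -> admissible M B C Y ->
  direct_code C X = direct_code C Y -> X = Y.
Proof.
have small Z : admissible M B C Z -> #|Z| <= P * (4 * B).
  move=> [CZ _ cZ]; rewrite -[X in X * _]card_ord -sum_nat_const.
  apply: leq_trans (leq_sum _ (fun p _ => cZ p)).
  rewrite -sum1_card.
  under [leqRHS]eq_bigr => p _ do rewrite -sum1_card big_mkcond /=.
  rewrite exchange_big /= big_mkcond; apply: leq_sum => i _.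
  case: ifP => // /[dup] iZ /CZ; case Ci: (C i) => [p|//] _.
  by rewrite (bigD1 p) //= inE iZ Ci eqxx.
by move=> /small sX /small sY /(congr1 val); rewrite !to_smallK.
Qed.

(** Costs about P B log(M/B), each cache contributing a small subset of its own content. *)
Definition cachewise_code (C : {ffun 'I_N -> option 'I_P}) (X : {set 'I_N}) :
    {ffun 'I_P -> small_set 'I_(2 * M + 2 * B) (4 * B)} :=
  [ffun p => to_small (4 * B)
    (rank_code (2 * M + 2 * B) [set i | C i == Some p]
       [set i in X | C i == Some p])].

Lemma cachewise_code_inj (C : {ffun 'I_N -> option 'I_P}) (X Y : {set 'I_N}) :
  admissible M B C X -> admissible M B C Y ->
  cachewise_code C X = cachewise_code C Y -> X = Y.
Proof.
move=> [CX cC cX] [CY _ cY] /ffunP E.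
have EX p : [set i in X | C i == Some p] = [set i in Y | C i == Some p].
  have := E p; rewrite !ffunE => /(congr1 val); rewrite !to_smallK.
  - apply: rank_code_inj; first exact: cC.
    + by apply/fintype.subsetP => i; rewrite !inE => /andP[].
    + by apply/fintype.subsetP => i; rewrite !inE => /andP[].
  - exact: leq_trans (card_rank_code _ _ _) (cY p).
  - exact: leq_trans (card_rank_code _ _ _) (cX p).
apply/setP => i; apply/idP/idP => iX.
- have := CX i iX; case Ci: (C i) => [p|//] _.
  by have /setP/(_ i) := EX p; rewrite !inE iX Ci eqxx !andbT => <-.
have := CY i iX; case Ci: (C i) => [p|//] _.
by have /setP/(_ i) := EX p; rewrite !inE iX Ci eqxx !andbT => ->.
Qed.

End Selectors.

(** * Logarithmic estimates for factorials and small subsets *)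

Section LogCounts.
Variable R : realType.

Lemma ln_le_subr1 (x : R) : 0 < x -> ln x <= x - 1.
Proof.
move=> x0; have := expR_ge1Dx (ln x); rewrite lnK //.
by rewrite lerBrDl.
Qed.

Lemma ln_ge_half (x : R) : 2 <= x -> 2^-1 <= ln x.
Proof.
move=> x2; have x0 : 0 < x by lra.
have : ln x^-1 <= x^-1 - 1 by rewrite ln_le_subr1 ?invr_gt0.
rewrite lnV //; have : x^-1 <= 2^-1 by rewrite lef_pV2 // posrE.
lra.
Qed.

Lemma sum_expr_card (T : finType) (x : R) :
  \sum_(X : {set T}) x ^+ #|X| = (x + 1) ^+ #|T|.
Proof.
rewrite exprD1n.
rewrite (partition_big (fun X : {set T} => inord #|X| : 'I_#|T|.+1) xpredT) //=.
apply: eq_bigr => j _.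
have Ej (X : {set T}) : (inord #|X| == j) = (#|X| == j).
  by rewrite -val_eqE /= inordK // ltnS max_card.
under eq_bigl => X do rewrite Ej.
rewrite (eq_bigr (fun=> x ^+ j)) => [|X /eqP -> //].
rewrite sumr_const; congr (_ *+ _).
rewrite -(card_draws T j) -[RHS]cardsE; apply: eq_card => X.
by rewrite !inE.
Qed.

(** Give each set X the weight x^#|X| with x = 1/y <= 1. Each small set weighs at least x^k, and the
    total weight (1 + x)^#|T| is at most exp(x #|T|) <= exp(k). *)
Lemma card_small_set (T : finType) (k : nat) (y : R) :
  1 <= y -> #|T|%:R <= k%:R * y ->
  ln (#|{: small_set T k}|%:R : R) <= k%:R * (1 + ln y).
Proof.
move=> y1 Tk; have y0 : 0 < y by lra.
set c : R := _%:R.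
have c0 : 0 < c.
  by rewrite ltr0n; apply/card_gt0P; exists (to_small k finset.set0).
have x0 : 0 < y^-1 by rewrite invr_gt0.
have x1 : y^-1 <= 1 by rewrite invf_le1.
have : c * y^-1 ^+ k <= (y^-1 + 1) ^+ #|T|.
  rewrite -sum_expr_card.
  rewrite (bigID (fun X : {set T} => (#|X| <= k)%N)) /=.
  rewrite -[leLHS]addr0 lerD //; last first.
    by apply: sumr_ge0 => X _; rewrite exprn_ge0 // ltW.
  have -> : c = \sum_(X : {set T} | (#|X| <= k)%N) 1.
    by rewrite sumr_const /c card_sub; congr (_%:R); apply: eq_card => X; rewrite !inE.
  rewrite mulr_suml; apply: ler_sum => X Xk.
  by rewrite mul1r; apply: ler_wiXn2l => //; exact: ltW.
have z0 : 0 < y^-1 + 1 by rewrite addr_gt0.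
move=> h; have := h; rewrite -ler_ln ?posrE ?mulr_gt0 ?exprn_gt0 //.
rewrite lnM ?posrE ?exprn_gt0 // !lnXn // lnV // => {}h.
have : ln (y^-1 + 1) *+ #|T| <= y^-1 * #|T|%:R.
  rewrite -[leLHS]mulr_natr ler_wpM2r //.
  by apply: le_trans (ln_le_subr1 z0) _; rewrite addrK.
have : y^-1 * #|T|%:R <= k%:R.
  by rewrite mulrC ler_pdivrMr.
move: h; rewrite mulNrn -[ln y *+ k]mulr_natl; lra.
Qed.

(** Weak Stirling bound; the induction step amounts to n ln((n + 1)/n) <= 1. *)
Lemma ln_fact (n : nat) : n%:R * ln n%:R - n%:R <= ln (n`!%:R : R).
Proof.
elim: n => [|n IH]; first by rewrite fact0 ln1 mul0r subr0.
rewrite factS natrM lnM ?posrE ?ltr0n ?fact_gt0 //.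
case: n IH => [_|n IH].
  by rewrite fact0 ln1 mul1r; lra.
have n0 : 0 < (n.+1%:R : R) by rewrite ltr0n.
have n1 : 0 < (n.+2%:R : R) by rewrite ltr0n.
have : ln (n.+2%:R / n.+1%:R) <= (n.+2%:R / n.+1%:R : R) - 1.
  by rewrite ln_le_subr1 // divr_gt0.
rewrite ln_div //.
have -> : (n.+2%:R / n.+1%:R : R) - 1 = n.+1%:R^-1.
  by rewrite -[n.+2%:R]natr1 mulrDl divff ?gt_eqF // mul1r addrAC subrr add0r.
rewrite -(ler_pM2l n0) mulfV ?gt_eqF // => h.
rewrite -[n.+2%:R]natr1 in h n1 IH *; lra.
Qed.

End LogCounts.

(** * From the count of schedules to the term [perm_bound] *)

Section ScheduleBound.
Variable R : realType.

Lemma ln_schedule_count (N B P T c : nat) :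
  (0 < N)%N -> (0 < B)%N -> (0 < c)%N ->
  (N`! <= 2 ^ N * (N * (4 * B).+1) ^ N./2
          * ((N.+1 * 2 ^ (2 * B)) ^ P * c * c) ^ T)%N ->
  ln (N`!%:R : R) <= N%:R * ln 2 + N./2%:R * (ln N%:R + ln (4 * B).+1%:R)
    + T%:R * (P%:R * (ln N.+1%:R + 2 * B%:R * ln 2) + 2 * ln c%:R).
Proof.
move=> N0 B0 c0; rewrite -(ler_nat R) => h.
apply: le_trans (_ : ln ((2 ^ N * (N * (4 * B).+1) ^ N./2
          * ((N.+1 * 2 ^ (2 * B)) ^ P * c * c) ^ T)%N%:R : R) <= _).
  rewrite ler_ln ?posrE ?ltr0n ?fact_gt0 //.
  by rewrite !(muln_gt0, expn_gt0) N0 c0.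
have pos (m : nat) : (0 < m)%N -> (m%:R : R) \is Num.pos by rewrite posrE ltr0n.
have pw (m k : nat) : (0 < m)%N -> ln ((m ^ k)%N%:R : R) = k%:R * ln m%:R.
  by move=> m0; rewrite natrX lnXn ?ltr0n // mulr_natl.
have ml (m k : nat) : (0 < m)%N -> (0 < k)%N ->
    ln ((m * k)%N%:R : R) = ln m%:R + ln k%:R.
  by move=> m0 k0; rewrite natrM lnM ?pos.
rewrite !ml ?pw ?ml ?pw ?ml ?pw //;
  try by rewrite !(muln_gt0, expn_gt0) ?N0 ?c0.
by rewrite natrM; lra.
Qed.

(** The base d of the logarithm in [perm_bound]. *)
Definition fan_out (P N M B : nat) : R :=
  Num.max 2 (Num.min (M%:R / B%:R) (N%:R / (P%:R * B%:R))).

(** Comparing ln N! with the count leaves N/4 ln(N/B) <= T P E, where E is the information per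
    processor and round. Whichever summand of E dominates selects the term of the minimum that is
    bounded. *)
Lemma code_count_bound (N M B P T : nat) (K : finType)
    (enc : {ffun 'I_N -> option 'I_P} -> {set 'I_N} -> K) :
  (0 < B)%N -> (0 < P)%N -> (P * B <= N)%N ->
  (forall C X Y, admissible M B C X -> admissible M B C Y ->
    enc C X = enc C Y -> X = Y) ->
  (0 < #|K|)%N ->
  ln (#|K|%:R : R) <= 12 * P%:R * B%:R * ln (fan_out P N M B) ->
  (forall pi : {perm 'I_N}, inhabited (schedule M B P pi T)) ->
  16 <= ln (N%:R / B%:R : R) ->
  perm_bound R P N M B <= 208 * T%:R.
Proof.
move=> B0 P0 PBN enc_inj K0 lnK scheds L16.
have BN : (B <= N)%N by apply: leq_trans PBN; rewrite leq_pmull.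
have N0 : (0 < N)%N by apply: leq_trans BN.
have := @card_scheduled N M B P B0 T K enc enc_inj [set: {perm 'I_N}]
  (fun pi _ => scheds pi).
rewrite cardsT card_Sn => /(ln_schedule_count N0 B0 K0).
move/(le_trans (ln_fact R N)).
rewrite /perm_bound -/(fan_out P N M B).
have N0R : 0 < (N%:R : R) by rewrite ltr0n.
have B0R : 0 < (B%:R : R) by rewrite ltr0n.
have P0R : 0 < (P%:R : R) by rewrite ltr0n.
have B1R : 1 <= (B%:R : R) by rewrite ler1n.
have P1R : 1 <= (P%:R : R) by rewrite ler1n.
have N1R : 1 <= (N%:R : R) by rewrite ler1n.
have NB0 : 0 < (N%:R / B%:R : R) by rewrite divr_gt0.
have PB0 : 0 < (P%:R * B%:R : R) by rewrite mulr_gt0.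
have T0R : 0 <= (T%:R : R) by [].
have LE : ln (N%:R / B%:R : R) = ln N%:R - ln B%:R by rewrite ln_div.
have NB17 : 17 <= (N%:R / B%:R : R).
  by have := ln_le_subr1 NB0; lra.
set d := fan_out P N M B in lnK *.
have d2 : 2 <= d by rewrite /d /fan_out le_max lexx.
have d0 : 0 < d by lra.
have lnd : 2^-1 <= ln d by exact: ln_ge_half.
have lnd0 : 0 < ln d by lra.
have dNB : ln d <= ln (N%:R / B%:R).
  rewrite ler_ln ?posrE // /d /fan_out ge_max; apply/andP; split; first by lra.
  rewrite ge_min; apply/orP; right.
  rewrite ler_pM2l // lef_pV2 ?posrE //.
  by rewrite ler_peMl // ltW.
have ln2d : ln (2 : R) <= ln d by rewrite ler_ln ?posrE.
have ln21 : ln (2 : R) <= 1 by apply: le_trans (ln_le_subr1 _) _ => //; lra.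
have lnN0 : 0 <= ln (N%:R : R) by rewrite ln_ge0.
have lnB0 : 0 <= ln (B%:R : R) by rewrite ln_ge0.
have ln4B : ln ((4 * B).+1%:R : R) <= ln B%:R + 4.
  have E5 : (5 * B%:R : R) = (5 * B)%N%:R by rewrite natrM.
  apply: le_trans (_ : ln (5 * B%:R : R) <= _).
    rewrite E5 ler_ln ?posrE ?ltr0n ?muln_gt0 ?B0 // ler_nat.
    by rewrite (_ : 5 * B = 4 * B + B)%N; [rewrite -addn1 leq_add2l|rewrite -mulSnr].
  rewrite lnM ?posrE //.
  have : ln (5 : R) <= 5 - 1 by exact: ln_le_subr1.
  lra.
have h2 : 2 * N./2%:R <= (N%:R : R).
  by rewrite -natrM ler_nat mul2n -[leqRHS]odd_double_half leq_addl.
have h0 : 0 <= (N./2%:R : R) by [].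
(* 26 = 2 + 2 * 12: the ranks of a read, and two uses of [enc]. *)
set E := ln (N.+1%:R : R) + 26 * B%:R * ln d.
move=> main.
have {main} main : N%:R / 4 * ln (N%:R / B%:R) <= T%:R * (P%:R * E).
  have h1 : T%:R * (P%:R * (ln N.+1%:R + 2 * B%:R * ln 2) + 2 * ln #|K|%:R)
     <= T%:R * (P%:R * E).
    rewrite ler_wpM2l // /E.
    have : P%:R * (2 * B%:R * ln 2) <= P%:R * (2 * B%:R * ln d).
      by rewrite !ler_wpM2l // mulr_ge0 // ltW.
    move: lnK; lra.
  have h3 : N./2%:R * (ln N%:R + ln (4 * B).+1%:R)
      <= N%:R / 2 * (ln N%:R + ln B%:R + 4) :> R.
    apply: ler_pM => //; first by rewrite addr_ge0 // ln_ge0 // ler1n.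
      by lra.
    by lra.
  have h4 : N%:R * ln (2:R) <= N%:R.
    by rewrite -[leRHS]mulr1 ler_wpM2l // ltW.
  (* The threshold 16 lets half of N/2 ln(N/B) absorb the linear terms, which add up to 4 N. *)
  have h5 : 0 <= N%:R / 4 * (ln (N%:R / B%:R) - 16 : R).
    by rewrite mulr_ge0 ?subr_ge0 //; lra.
  move: main h1 h3 h4 h5; rewrite LE; lra.
have lnN1 : 0 <= ln (N.+1%:R : R) by rewrite ln_ge0 // ler1n.
(* If the ranks dominate, E <= 52 B ln d, and 4 * 52 = 208. Otherwise naming a block dominates and
   the bound N/P results. *)
have [cs|cs] := leP (ln (N.+1%:R : R)) (26 * B%:R * ln d).
  rewrite ge_min; apply/orP; right.
  rewrite /olog max_r; last by rewrite ler_pdivlMr // mul1r.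
  rewrite mulrA ler_pdivrMr // mulrAC ler_pdivrMr //.
  have : T%:R * (P%:R * E) <= T%:R * (P%:R * (52 * B%:R * ln d)).
    by rewrite ler_wpM2l // ler_wpM2l ?(ltW P0R) // /E; lra.
  lra.
rewrite ge_min; apply/orP; left.
have B13 : 13 * B%:R < ln (N.+1%:R : R).
  apply: le_lt_trans cs.
  have : 26 * B%:R * 2^-1 <= 26 * B%:R * ln d by rewrite ler_wpM2l //; lra.
  lra.
(* Here B is logarithmic in N, so ln(N/B) is at least half of ln N. *)
have BB : (B * B <= N)%N.
  rewrite leqNgt; apply/negP => NBB.
  have : ln (N.+1%:R : R) <= ln (B * B)%N%:R.
    by rewrite ler_ln ?posrE ?ltr0n ?muln_gt0 ?B0 // ler_nat.
  rewrite natrM lnM ?posrE //.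
  have := ln_le_subr1 B0R; lra.
have lnBB : 2 * ln (B%:R : R) <= ln N%:R.
  have -> : 2 * ln (B%:R : R) = ln (B * B)%N%:R by rewrite natrM lnM ?posrE //; lra.
  by rewrite ler_ln ?posrE ?ltr0n ?muln_gt0 ?B0 // ler_nat.
have lnNN : ln (N.+1%:R : R) <= 2 * ln N%:R.
  have -> : 2 * ln (N%:R : R) = ln (N * N)%N%:R by rewrite natrM lnM ?posrE //; lra.
  rewrite ler_ln ?posrE ?ltr0n ?muln_gt0 ?N0 // ler_nat.
  have N2 : (1 < N)%N.
    rewrite ltnNge; apply/negP => N1; have /ln_le_subr1 := N0R.
    have : (N%:R : R) <= 1 by rewrite lern1.
    by move: L16; rewrite LE; lra.
  by apply: leq_trans (_ : N * 2 <= _)%N; [rewrite muln2 -addnn -addn1 leq_add2l|rewrite leq_mul2l N2 orbT].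
have lnN16 : 0 < ln (N%:R : R) by move: L16; rewrite LE; lra.
rewrite ler_pdivrMr // -(ler_pM2r lnN16).
have h6 : T%:R * (P%:R * E) <= T%:R * (P%:R * (4 * ln N%:R)).
  by rewrite ler_wpM2l // ler_wpM2l ?(ltW P0R) // /E; lra.
have h7 : N%:R / 4 * (ln N%:R / 2) <= N%:R / 4 * ln (N%:R / B%:R : R).
  by rewrite ler_wpM2l //; rewrite ?LE; lra.
have h8 : 0 <= T%:R * (P%:R * ln (N%:R : R)).
  by rewrite !mulr_ge0.
lra.
Qed.

Lemma perm_bound_le_length (N M B P T : nat) :
  (0 < B)%N -> (0 < P)%N -> (P * B <= N)%N ->
  (forall pi : {perm 'I_N}, inhabited (schedule M B P pi T)) ->
  16 <= ln (N%:R / B%:R : R) ->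
  perm_bound R P N M B <= 208 * T%:R.
Proof.
move=> B0 P0 PBN scheds L16.
have B0R : 0 < (B%:R : R) by rewrite ltr0n.
have P0R : 0 < (P%:R : R) by rewrite ltr0n.
have PB0 : 0 < (P%:R * B%:R : R) by rewrite mulr_gt0.
have NPB1 : 1 <= (N%:R / (P%:R * B%:R) : R).
  by rewrite ler_pdivlMr // mul1r -natrM ler_nat.
set d := fan_out P N M B.
have d2 : 2 <= d by rewrite /d /fan_out le_max lexx.
have lnd : 2^-1 <= ln d by apply: ln_ge_half.
(* As ln d >= 1/2, the summand 1 costs at most 2 ln d; with k = 4 B per cache this gives the
   constant 12. *)
have small (k : nat) (y : R) : 1 <= y -> y <= d ->
    k%:R * (1 + ln y) <= k%:R * (3 * ln d).
  move=> y1 yd; rewrite ler_wpM2l //.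
  have : ln y <= ln d by rewrite ler_ln ?posrE //; lra.
  lra.
(* The encoding is chosen by which ratio attains the minimum in d. *)
have [c12|c12] := leP (Num.max 1 (M%:R / B%:R)) (N%:R / (P%:R * B%:R) : R).
- apply: (code_count_bound (enc := @cachewise_code N M B P)) scheds L16 => //.
  + exact: cachewise_code_inj.
  + by apply/card_gt0P; exists [ffun=> to_small (4 * B) finset.set0].
  rewrite card_ffun card_ord natrX lnXn; last first.
    by rewrite ltr0n; apply/card_gt0P; exists (to_small (4 * B) finset.set0).
  have y1 : 1 <= Num.max 1 (M%:R / B%:R) :> R by rewrite le_max lexx.
  have yd : Num.max 1 (M%:R / B%:R) <= d.
    rewrite /d /fan_out ge_max; apply/andP; split; first by rewrite le_max ler1n.
    have : M%:R / B%:R <= N%:R / (P%:R * B%:R) :> R.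
      by apply: le_trans c12; rewrite le_max lexx orbT.
    by move=> /min_idPl ->; rewrite le_max lexx orbT.
  have My : M%:R <= B%:R * Num.max 1 (M%:R / B%:R) :> R.
    rewrite mulrC -ler_pdivrMr //.
    by rewrite le_max lexx orbT.
  have By : B%:R <= B%:R * Num.max 1 (M%:R / B%:R) :> R.
    by rewrite ler_peMr // ltW.
  have /(card_small_set y1) h :
      #|'I_(2 * M + 2 * B)|%:R <= (4 * B)%N%:R * Num.max 1 (M%:R / B%:R) :> R.
    by rewrite card_ord natrD !natrM; lra.
  rewrite -[leLHS]mulr_natl -/d.
  apply: le_trans (ler_wpM2l (ltW P0R) (le_trans h (small _ _ y1 yd))) _.
  by rewrite natrM; lra.
apply: (code_count_bound (enc := @direct_code N B P)) scheds L16 => //.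
- exact: direct_code_inj.
- by apply/card_gt0P; exists (to_small _ finset.set0).
have yd : N%:R / (P%:R * B%:R) <= d.
  move: c12; rewrite lt_max => /orP[|/ltW/min_idPr E]; first by lra.
  by rewrite /d /fan_out E le_max lexx orbT.
have h : #|'I_N|%:R <= (P * (4 * B))%N%:R * (N%:R / (P%:R * B%:R)) :> R.
  rewrite card_ord !natrM.
  have -> : P%:R * (4 * B%:R) * (N%:R / (P%:R * B%:R)) = 4 * N%:R :> R.
    by field; rewrite !gt_eqF.
  by have : 0 <= N%:R :> R by []; lra.
apply: le_trans (le_trans (card_small_set NPB1 h) (small _ _ NPB1 yd)) _.
by rewrite -/d !natrM; lra.
Qed.

End ScheduleBound.

(** * From programs to schedules *)

Section Tracing.
Local Open Scope nat_scope.
Variables (A E : Type) (N M B P : nat).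
Variable sem : E -> cache_content A M -> cache_content A M.
Variables (lo hi : A -> nat) (ok Q : A -> Prop).

(* An atom [a] stands for the positions [lo a <= q < hi a].  [Q] is an invariant
   of all atoms of a run, [ok] a property inherited backwards from the output. *)
Definition concatenates (z x y : A) : Prop :=
  [/\ ok x, ok y, lo z = lo x /\ hi x = lo y, hi y = hi z
    & lo x <= hi x /\ lo y <= hi y].

Definition interval_sem : Prop :=
  forall e (c : cache_content A M), (forall k a, c k = Some a -> Q a) ->
  forall k z, sem e c k = Some z ->
    Q z /\ ((exists k', c k' = Some z) \/
            exists i j x y, [/\ c i = Some x, c j = Some y &
                             ok z -> concatenates z x y]).

Hypothesis semP : interval_sem.

(** [g k q] is the earlier cell of the atom that contributed position q to cell k. It is constant on
    each contributing atom, so an atom's positions are traced together. *)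
Definition nested (c c' : cache_content A M) (g : 'I_M -> nat -> 'I_M) : Prop :=
  forall k z, c' k = Some z -> ok z -> forall q, lo z <= q < hi z ->
    exists a, [/\ c (g k q) = Some a, ok a, lo z <= lo a <= q, q < hi a <= hi z
      & forall q', lo a <= q' < hi a -> g k q' = g k q].

Lemma run_localP (c : cache_content A M) (o : local_op E M) :
  (forall k a, c k = Some a -> Q a) ->
  forall k z, run_local sem c o k = Some z ->
    Q z /\ ((exists k', c k' = Some z) \/
            exists i j x y, [/\ c i = Some x, c j = Some y &
                             ok z -> concatenates z x y]).
Proof.
move=> cQ k z; case: o => [i j|i|e] /=; last exact: semP.
- rewrite ffunE; case: eqP => _ ck.
    by split; [exact: cQ ck|left; exists i].
  by split; [exact: cQ ck|left; exists k].
rewrite ffunE; case: eqP => // _ ck.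
by split; [exact: cQ ck|left; exists k].
Qed.

Lemma run_locals_inv (ops : seq (local_op E M)) (c : cache_content A M) :
  (forall k a, c k = Some a -> Q a) ->
  forall k a, foldl (run_local sem) c ops k = Some a -> Q a.
Proof.
elim: ops c => [//|o ops IH] c cQ /=; apply: IH => k a.
by case/(run_localP cQ).
Qed.

Lemma nested_local (c : cache_content A M) (o : local_op E M) :
  (forall k a, c k = Some a -> Q a) ->
  exists g, nested c (run_local sem c o) g.
Proof.
move=> cQ.
have [g gP] : {g : 'I_M -> nat -> 'I_M & forall k z, run_local sem c o k = Some z ->
    ok z -> forall q, lo z <= q < hi z ->
    exists a, [/\ c (g k q) = Some a, ok a, lo z <= lo a <= q, q < hi a <= hi z
      & forall q', lo a <= q' < hi a -> g k q' = g k q]}.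
  apply: (@choice _ _ (fun k h => forall z, run_local sem c o k = Some z ->
    ok z -> forall q, lo z <= q < hi z ->
    exists a, [/\ c (h q) = Some a, ok a, lo z <= lo a <= q, q < hi a <= hi z
      & forall q', lo a <= q' < hi a -> h q' = h q])) => k.
  case ck: (run_local sem c o k) => [z|]; last by exists (fun=> k).
  have [_ [[k' ck']|[i [j [x [y [ci cj cat]]]]]]] := run_localP cQ ck.
    exists (fun=> k') => _ [<-] okz q qz; exists z.
    by move: qz => /andP[-> ->]; rewrite !leqnn.
  exists (fun q => if q < lo y then i else j) => _ [<-] okz q /andP[zq qz].
  have [okx oky [Ez Exy] Eyz [lex ley]] := cat okz.
  case: ltnP => qy.
    exists x; split=> // [||q' /andP[_]].
    + by rewrite Ez leqnn -Ez.
    + by rewrite Exy qy -Eyz.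
    + by rewrite Exy => ->.
  exists y; split=> // [||q' /andP[yq' _]].
  - by rewrite qy Ez andbT -Exy.
  - by rewrite Eyz qz leqnn.
  - by rewrite ltnNge yq'.
by exists g.
Qed.

Lemma nested_locals (ops : seq (local_op E M)) (c : cache_content A M) :
  (forall k a, c k = Some a -> Q a) ->
  exists g, nested c (foldl (run_local sem) c ops) g.
Proof.
elim: ops c => [|o ops IH] c cQ /=.
  exists (fun k _ => k) => k z ck okz q /andP[zq qz]; exists z.
  by rewrite zq qz !leqnn.
have [h hP] := nested_local o cQ.
have [|g gP] := IH (run_local sem c o); first by move=> k a /(run_localP cQ)[].
exists (fun k q => h (g k q) q) => k z ck okz q qz.
have [a [ca oka /andP[za aq] /andP[qa az] ga]] := gP k z ck okz q qz.
have [|a' [ca' oka' /andP[aa aq'] /andP[qa' aa'] ha]] := hP _ a ca oka q.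
  by rewrite aq.
exists a'; split=> //.
- by rewrite (leq_trans za aa).
- by rewrite qa' (leq_trans aa' az).
move=> q' /andP[a'q' q'a']; rewrite ga; first by apply: ha; rewrite a'q'.
by rewrite (leq_trans aa a'q') (leq_trans q'a' aa').
Qed.

Definition cell : Type := (nat * 'I_B + 'I_P * 'I_M)%type.

Definition content (cf : config A P M B) (x : cell) : option A :=
  match x with
  | inl (b, k) => shared cf b k
  | inr (p, i) => cache cf p i
  end.

Definition place_of (x : cell) : place P :=
  match x with inl (b, _) => inl b | inr (p, _) => inr p end.

Definition read_block (r : round E P M B) (p : 'I_P) : option nat :=
  if (r p).2 is Read b _ then Some b else None.

Definition write_block (r : round E P M B) (p : 'I_P) : option nat :=
  if (r p).2 is Write b _ then Some b else None.

Lemma writtenP (r : round E P M B) p b g :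
  written b (r p).2 = Some g -> write_block r p = Some b.
Proof.
by rewrite /write_block; case: (r p).2 => //= b' g'; case: eqP => // ->.
Qed.

Lemma write_blockP (r : round E P M B) p b :
  write_block r p = Some b -> written b (r p).2 : Prop.
Proof.
by rewrite /write_block; case: (r p).2 => //= b' g' [->]; rewrite eqxx.
Qed.

Definition all_atoms (cf : config A P M B) : Prop :=
  forall x a, content cf x = Some a -> Q a.

(** Selects one copy per position; the last clause gives all positions of a selected atom to that
    same cell, which the capacity bound relies on. *)
Definition traced (cf : config A P M B) (c : 'I_N -> cell) : Prop :=
  forall q : 'I_N, exists a, [/\ content cf (c q) = Some a, ok a, lo a <= q < hi a
    & forall q' : 'I_N, lo a <= q' < hi a -> c q' = c q].

Definition after_local (cf : config A P M B) (r : round E P M B) (p : 'I_P) :=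
  foldl (run_local sem) (cache cf p) (r p).1.

Variant round_origin (cf : config A P M B) (r : round E P M B) (a : A) :
    cell -> Prop :=
  | FromCache p i of after_local cf r p i = Some a :
      round_origin cf r a (inr (p, i))
  | FromRead p i b k of read_block r p = Some b & shared cf b k = Some a :
      round_origin cf r a (inr (p, i))
  | FromWrite b k p i of write_block r p = Some b & after_local cf r p i = Some a :
      round_origin cf r a (inl (b, k))
  | FromBlock b k of (forall p, write_block r p <> Some b) & shared cf b k = Some a :
      round_origin cf r a (inl (b, k)).

Lemma round_originP cf r x a :
  content (run_round sem cf r) x = Some a -> round_origin cf r a x.
Proof.
case: x => [[b k]|[p i]] /=.
  case: pickP => [p|no].
    case W: (written b (r p).2) => [g|//] _.
    rewrite ffunE; case: (g k) => // i ci.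
    exact: FromWrite (writtenP W) ci.
  by apply: FromBlock => p /write_blockP; rewrite no.
case R: (r p).2 => [|b g|b g] /=; try exact: FromCache.
rewrite ffunE; case: (g i) => [k|]; last exact: FromCache.
by apply: FromRead; rewrite /read_block R.
Qed.

Lemma all_atoms_round cf r : all_atoms cf -> all_atoms (run_round sem cf r).
Proof.
move=> cQ x a /round_originP[p i|p i b k _|b k p i _|b k _].
- by apply: run_locals_inv => j a'; exact: (cQ (inr (p, j))).
- exact: (cQ (inl (b, k))).
- by apply: run_locals_inv => j a'; exact: (cQ (inr (p, j))).
- exact: (cQ (inl (b, k))).
Qed.

(** One step backwards in time: the atom covering q arose in a cache, was read, was written or
    rested, and its contributor covering q takes over with a nested interval. *)
Lemma traced_round (cf : config A P M B) (r : round E P M B) c' :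
  all_atoms cf -> traced (run_round sem cf r) c' ->
  exists c, traced cf c /\
    forall q, legal_move (read_block r) (write_block r) (place_of (c q)) (place_of (c' q)).
Proof.
move=> cQ tr.
have [g gP] : {g : 'I_P -> 'I_M -> nat -> 'I_M &
    forall p, nested (cache cf p) (after_local cf r p) (g p)}.
  apply: (@choice _ _ (fun p h => nested (cache cf p) (after_local cf r p) h)) => p.
  by apply: nested_locals => k a; exact: (cQ (inr (p, k))).
have [orig origP] : {o : cell -> nat -> cell & forall x z,
    content (run_round sem cf r) x = Some z -> ok z ->
    forall q, lo z <= q < hi z ->
    legal_move (read_block r) (write_block r) (place_of (o x q)) (place_of x) /\
    exists a, [/\ content cf (o x q) = Some a, ok a, lo z <= lo a <= q,
      q < hi a <= hi z & forall q', lo a <= q' < hi a -> o x q' = o x q]}.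
  apply: (@choice _ _ (fun x f => forall z,
    content (run_round sem cf r) x = Some z -> ok z ->
    forall q, lo z <= q < hi z ->
    legal_move (read_block r) (write_block r) (place_of (f q)) (place_of x) /\
    exists a, [/\ content cf (f q) = Some a, ok a, lo z <= lo a <= q,
      q < hi a <= hi z & forall q', lo a <= q' < hi a -> f q' = f q])) => x.
  case cx: (content _ x) => [z|]; last by exists (fun=> x).
  have stay (y : cell) : content cf y = Some z ->
      legal_move (read_block r) (write_block r) (place_of y) (place_of x) ->
      forall z', Some z = Some z' -> ok z' -> forall q, lo z' <= q < hi z' ->
      legal_move (read_block r) (write_block r) (place_of y) (place_of x) /\
      exists a, [/\ content cf y = Some a, ok a, lo z' <= lo a <= q,
        q < hi a <= hi z' & forall q', lo a <= q' < hi a -> y = y].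
    move=> cy mv z' [<-] okz q /andP[zq qz]; split=> //; exists z.
    by rewrite zq qz !leqnn.
  have from_cache p i : after_local cf r p i = Some z ->
      legal_move (read_block r) (write_block r) (inr p) (place_of x) ->
      forall z', Some z = Some z' -> ok z' -> forall q, lo z' <= q < hi z' ->
      legal_move (read_block r) (write_block r) (inr p) (place_of x) /\
      exists a, [/\ cache cf p (g p i q) = Some a, ok a, lo z' <= lo a <= q,
        q < hi a <= hi z' & forall q', lo a <= q' < hi a ->
        inr (p, g p i q') = inr (p, g p i q) :> cell].
    move=> ci mv z' [<-] okz q qz; split=> //.
    have [a [h1 h2 h3 h4 h5]] := gP p i z ci okz q qz.
    by exists a; split=> // q' /h5 ->.
  case: (round_originP cx) stay from_cache =>
    [p i ci|p i b k rb sb|b k p i wb ci|b k nw sb] stay from_cache.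
  - by exists (fun q => inr (p, g p i q)); exact: from_cache.
  - by exists (fun=> inl (b, k)); exact: stay.
  - by exists (fun q => inr (p, g p i q)); exact: from_cache.
  - by exists (fun=> inl (b, k)); exact: stay.
exists (fun q => orig (c' q) q); split=> q; have [z [cz okz qz zc]] := tr q; last first.
  by have [] := origP _ _ cz okz q qz.
have [_ [a [ca oka /andP[za aq] /andP[qa az] ho]]] := origP _ _ cz okz q qz.
exists a; split=> //; first by rewrite aq.
move=> q' /andP[aq' q'a]; rewrite zc; first by apply: ho; rewrite aq'.
by rewrite (leq_trans za aq') (leq_trans q'a az).
Qed.

Lemma traced_run (pr : program E P M B) (cf : config A P M B) cT :
  all_atoms cf -> traced (run sem cf pr) cT ->
  exists c : nat -> 'I_N -> cell,
    [/\ c (size pr) = cT,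
        forall t, t <= size pr -> traced (run sem cf (take t pr)) (c t)
      & forall t q, t < size pr ->
        legal_move (read_block (nth (idle_round E P M B) pr t))
             (write_block (nth (idle_round E P M B) pr t))
             (place_of (c t q)) (place_of (c t.+1 q))].
Proof.
elim: pr cf => [|r pr IH] cf cQ tr /=.
  by exists (fun=> cT); split=> //; case.
have [c [cE ctr cmv]] := IH _ (all_atoms_round cQ) tr.
have tr0 := ctr 0 (leq0n _); rewrite take0 in tr0.
have [c0 [c0tr c0mv]] := traced_round cQ tr0.
exists (fun t => if t is s.+1 then c s else c0); split=> [//|[|t]|[|t]] //=.
- exact: ctr.
- exact: cmv.
Qed.

Variables (x : 'I_N -> A) (pi : {perm 'I_N}).
Hypotheses (B_gt0 : 0 < B) (xQ : forall i, Q (x i)).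
Hypotheses (lo_x : forall q, lo (x (pi q)) = q) (hi_x : forall q, hi (x (pi q)) = q.+1).

Lemma initialP (y : cell) a : content (initial P M B x) y = Some a ->
  exists i, a = x i /\ place_of y = inl (i %/ B).
Proof.
case: y => [[b k]|[p i]] /=; rewrite ffunE //.
case: insubP => //= i _ Ei [<-]; exists i; split=> //.
by rewrite Ei divnMDl // divn_small ?addn0 ?ltn_ord.
Qed.

Lemma lo_hi_x i : lo (x i) = (pi^-1)%g i /\ hi (x i) = ((pi^-1)%g i).+1.
Proof. by rewrite -[in x i](permKV pi i). Qed.

(** If an interval contains two positions of equal parity, it contains the right partner of the
    smaller (even case) or the left partner of the larger (odd case). So at most one position of
    each parity is apart from its partner. *)
Lemma traced_partner cf c q q' : traced cf c -> c q = c q' -> odd q = odd q' ->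
  q < q' -> c q = c (partner q) \/ c q' = c (partner q').
Proof.
move=> tr Ec Eodd qq'.
have [a [ca _ /andP[aq qa] ha]] := tr q.
have [a' [ca' _ /andP[aq' qa'] _]] := tr q'.
have Ea : a' = a by move: ca'; rewrite -Ec ca => -[].
subst a'; case: (boolP (odd q)) => oq; [right|left].
  rewrite -Ec; apply/esym/ha; rewrite val_insubd -Eodd oq.
  have lt : q'.-1 < N by rewrite (leq_ltn_trans (leq_pred _)).
  by rewrite lt; lia.
apply/esym/ha; rewrite val_insubd (negPf oq).
have lt : q.+1 < N by have := ltn_ord q'; lia.
by rewrite lt; lia.
Qed.

Lemma traced_capacity cf c y : traced cf c ->
  #|[set i | (place_of (c ((pi^-1)%g i)) == y)
       && (place_of (c ((pi^-1)%g (mate pi i))) != y)]| <= capacity M B y.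
Proof.
move=> tr.
(* Cell and parity determine a token apart from its partner, whence 2 * B and 2 * M. *)
pose f i : (('I_B * bool) + ('I_M * bool))%type :=
  let q := (pi^-1)%g i in
  match c q with inl (_, k) => inl (k, odd q) | inr (_, k) => inr (k, odd q) end.
set X := [set i | _].
have finj : {in X &, injective f}.
  move=> i j; rewrite !inE /mate !permK => /andP[/eqP iy im] /andP[/eqP jy jm] Ef.
  have [Ec Eo] : c ((pi^-1)%g i) = c ((pi^-1)%g j) /\ odd ((pi^-1)%g i) = odd ((pi^-1)%g j).
    move: Ef iy jy; rewrite /f /=.
    case: (c ((pi^-1)%g i)) => [[b k]|[p k]]; case: (c ((pi^-1)%g j)) => [[b' k']|[p' k']] //=.
      by move=> [-> ->] <- [->].
    by move=> [-> ->] <- [->].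
  apply: (@perm_inj _ (pi^-1)%g); apply: val_inj => /=.
  case: (ltngtP ((pi^-1)%g i) ((pi^-1)%g j)) => // lt.
    case: (traced_partner tr Ec Eo lt) => E0.
      by move: im; rewrite -E0 iy eqxx.
    by move: jm; rewrite -E0 jy eqxx.
  case: (traced_partner tr (esym Ec) (esym Eo) lt) => E0.
    by move: jm; rewrite -E0 jy eqxx.
  by move: im; rewrite -E0 iy eqxx.
rewrite -(card_in_imset finj).
case: y @X finj => [b|p] X _ /=.
  apply: leq_trans (_ : #|[set (inl kb : ('I_B * bool) + ('I_M * bool)) | kb in [set: 'I_B * bool]]| <= _).
    apply/subset_leq_card/fintype.subsetP => z /imsetP[i]; rewrite inE => /andP[/eqP iy _] ->.
    move: iy; rewrite /f /=; case: (c ((pi^-1)%g i)) => [[b' k]|[p k]] //= _.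
    by apply/imsetP; exists (k, odd ((pi^-1)%g i)); rewrite ?inE.
  by rewrite card_imset ?cardsT ?card_prod ?card_ord ?card_bool 1?mulnC //; move=> ? ? [].
apply: leq_trans (_ : #|[set (inr kb : ('I_B * bool) + ('I_M * bool)) | kb in [set: 'I_M * bool]]| <= _).
  apply/subset_leq_card/fintype.subsetP => z /imsetP[i]; rewrite inE => /andP[/eqP iy _] ->.
  move: iy; rewrite /f /=; case: (c ((pi^-1)%g i)) => [[b' k]|[p' k]] //= _.
  by apply/imsetP; exists (k, odd ((pi^-1)%g i)); rewrite ?inE.
by rewrite card_imset ?cardsT ?card_prod ?card_ord ?card_bool 1?mulnC //; move=> ? ? [].
Qed.

Lemma schedule_of_run (pr : program E P M B) cT :
  crew pr -> traced (run sem (initial P M B x) pr) cT ->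
  (forall q, place_of (cT q) = place_of (cT (partner q))) ->
  exists S : schedule M B P pi (size pr),
    forall i, loc S (size pr) i = place_of (cT ((pi^-1)%g i)).
Proof.
move=> cr tr fin.
have Q0 : all_atoms (initial P M B x) by move=> y a /initialP[i [-> _]].
have [c [cE ctr cmv]] := traced_run Q0 tr.
pose r t := nth (idle_round E P M B) pr t.
(* Input atoms cover a single position, so the trace of token i must start at a cell holding
   [x i]. *)
have H0 i : place_of (c 0 ((pi^-1)%g i)) = inl (i %/ B).
  have := ctr 0 (leq0n _); rewrite take0 => tr0.
  have [a [/initialP[j [-> ->]] _ /andP[] h1 h2 _]] := tr0 ((pi^-1)%g i).
  have [El Eh] := lo_hi_x j; rewrite El in h1; rewrite Eh ltnS in h2.
  have /perm_inj -> // : (pi^-1)%g i = (pi^-1)%g j.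
  by apply: val_inj; apply/eqP; rewrite eqn_leq h1 h2.
have Hex t p q b : write_block (r t) p = Some b -> write_block (r t) q = Some b -> p = q.
  have [tp|tp] := ltnP t (size pr).
    by move=> /write_blockP wp /write_blockP wq; exact: cr tp p q b wp wq.
  by rewrite /r nth_default // /write_block ffunE.
have Hmv t i : t < size pr -> legal_move (read_block (r t)) (write_block (r t))
    (place_of (c t ((pi^-1)%g i))) (place_of (c t.+1 ((pi^-1)%g i))).
  exact: cmv.
have Hcap t y : t <= size pr ->
    #|[set i | (place_of (c t ((pi^-1)%g i)) == y)
        && (place_of (c t ((pi^-1)%g (mate pi i))) != y)]| <= capacity M B y.
  by move=> /ctr; exact: traced_capacity.
have Hend i : place_of (c (size pr) ((pi^-1)%g i)) =
    place_of (c (size pr) ((pi^-1)%g (mate pi i))).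
  by rewrite cE /mate permK fin.
exists (Schedule H0 Hex Hmv Hcap Hend) => i /=.
by rewrite cE.
Qed.

End Tracing.

(** * Doubling: gathering all tokens takes logarithmic time *)

Section Gathering.
Local Open Scope nat_scope.
Variables (N M B P : nat) (pi : {perm 'I_N}) (T : nat).
Variable S : schedule M B P pi T.
Hypothesis B_gt0 : 0 < B.

(** The tokens in a place come from at most two places: for a cache, itself and the block read; for
    a block, its writer or itself. Here dead tokens count as well. *)
Lemma card_place t y : t <= T -> #|[set i | loc S t i == y]| <= B * 2 ^ t.
Proof.
elim: t y => [|t IH] y tT.
  rewrite muln1; case: y => [b|p]; last first.
    by rewrite (_ : [set i | _] = finset.set0) ?cards0 //; apply/setP => i; rewrite !inE loc0.
  have [f fP] : {f : 'I_N -> 'I_B & forall i, val (f i) = i %% B}.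
    by exists (fun i => Ordinal (ltn_pmod i B_gt0)).
  rewrite -[X in _ <= X]card_ord; apply: (@leq_card_in _ _ f) => i k.
  rewrite !inE !loc0 => /eqP[Ei] /eqP[Ek] /(congr1 val).
  by rewrite !fP => Em; apply: val_inj; rewrite /= (divn_eq i B) (divn_eq k B) Ei Ek Em.
have {}IH y := IH y (ltnW tT).
have sub (X : {set 'I_N}) : [set i | loc S t.+1 i == y] \subset X ->
    #|X| <= B * 2 ^ t + B * 2 ^ t -> #|[set i | loc S t.+1 i == y]| <= B * 2 ^ t.+1.
  by move=> /subset_leq_card h /(leq_trans h); rewrite addnn -mul2n mulnCA -expnS.
case: y sub => [b|p] sub.
  have [p wp|nw] := pickP [pred p | wr S t p == Some b].
    apply: (sub [set i | loc S t i == inr p]); last exact: leq_trans (IH _) (leq_addr _ _).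
    apply/fintype.subsetP => i; rewrite !inE.
    have := loc_move S i tT; rewrite /legal_move => + /eqP Ei; rewrite Ei.
    case: (loc S t i) => [b'|q]; last first.
      by move=> wq; apply/eqP; congr inr; apply: wr_excl wq _; exact/eqP.
    by move=> [-> nw]; case: (nw p); exact/eqP.
  apply: (sub [set i | loc S t i == inl b]); last exact: leq_trans (IH _) (leq_addr _ _).
  apply/fintype.subsetP => i; rewrite !inE.
  have := loc_move S i tT; rewrite /legal_move => + /eqP Ei; rewrite Ei.
  case: (loc S t i) => [b' [->] //|q /eqP wq].
  by have := nw q; rewrite /= wq.
case rp: (rd S t p) => [b|].
  apply: (sub ([set i | loc S t i == inr p] :|: [set i | loc S t i == inl b])).
    apply/fintype.subsetP => i; rewrite !inE.
    have := loc_move S i tT; rewrite /legal_move => + /eqP Ei; rewrite Ei.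
    by case: (loc S t i) => [b'|q]; rewrite ?rp; [move=> [->]|move=> ->]; rewrite eqxx ?orbT.
  by apply: leq_trans (leq_card_setU _ _) (leq_add (IH _) (IH _)).
apply: (sub [set i | loc S t i == inr p]); last exact: leq_trans (IH _) (leq_addr _ _).
apply/fintype.subsetP => i; rewrite !inE.
have := loc_move S i tT; rewrite /legal_move => + /eqP Ei; rewrite Ei.
by case: (loc S t i) => [b'|q]; rewrite ?rp // => ->.
Qed.

Lemma gathered_length y : (forall i, loc S T i = y) -> N <= B * 2 ^ T.
Proof.
move=> gat; apply: leq_trans (card_place y (leqnn T)).
rewrite -[X in X <= _]card_ord -cardsT.
by apply/subset_leq_card/fintype.subsetP => i _; rewrite inE gat.
Qed.

End Gathering.

(** * Proximate neighbors yield schedules *)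

Section Proximate.
Local Open Scope nat_scope.
Variables N M B P : nat.

Lemma half_partner (q : 'I_N) : (partner q)./2 = q./2.
Proof.
rewrite val_insubd; case: (boolP (odd q)) => oq; case: ifP => // _; lia.
Qed.

Definition labels_positions (pi : {perm 'I_N}) (l : labeling N) : Prop :=
  forall i, label l i = ((pi^-1)%g i)./2 :> nat.

Lemma labeling_of_perm (pi : {perm 'I_N}) :
  ~~ odd N -> exists l : labeling N, labels_positions pi l.
Proof.
move=> eN.
have lt (i : 'I_N) : ((pi^-1)%g i)./2 < N./2 by have := ltn_ord ((pi^-1)%g i); lia.
pose f : {ffun 'I_N -> 'I_N./2} := [ffun i => Ordinal (lt i)].
suff fP : [forall a, #|[set i | f i == a]| == 2].
  by exists (exist _ f fP) => i; rewrite /label /= ffunE.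
apply/forallP => a.
have -> : [set i | f i == a] = [set pi (pair_fst a); pi (pair_snd a)].
  apply/setP => i; rewrite !inE ffunE -val_eqE /=.
  have ipi j : (i == pi j) = ((pi^-1)%g i == j).
    by rewrite -{1}(permKV pi i) (inj_eq perm_inj).
  rewrite !ipi -!val_eqE /=.
  move: (nat_of_ord _) (nat_of_ord a) => m n; lia.
by rewrite cards2 (inj_eq perm_inj) -val_eqE /= neq_ltn ltnSn.
Qed.

Lemma atomic_interval_sem (lo hi : 'I_N -> nat) :
  interval_sem (@atomic_sem 'I_N M) lo hi (fun=> True) (fun=> True).
Proof. by case. Qed.

(** Each atom is the unit interval at its position, and the trace ends in the block that the
    solution provides for its label, which partners share. *)
Lemma proximate_schedule (pi : {perm 'I_N}) (l : labeling N)
    (pr : program void P M B) :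
  0 < B -> labels_positions pi l -> solves_proximate l pr ->
  inhabited (schedule M B P pi (size pr)).
Proof.
move=> B0 lP [cr sol].
have [blk blkP] := choice sol.
have [k kP] : {k : 'I_N -> 'I_B &
    forall q, shared (run_atomic N pr) (blk (label l (pi q))) (k q) = Some (pi q)}.
  apply: (@choice _ _ (fun q k =>
    shared (run_atomic N pr) (blk (label l (pi q))) k = Some (pi q))) => q.
  exact: blkP.
pose cT q : cell M B P := inl (blk (label l (pi q)), k q).
pose lo (i : 'I_N) : nat := (pi^-1)%g i.
have [|||||S _] := @schedule_of_run _ _ N M B P (@atomic_sem 'I_N M) lo (S \o lo)
  (fun=> True) (fun=> True) (@atomic_interval_sem lo (S \o lo)) id pi B0 _ _ _ pr cT cr.
- by [].
- by move=> q; rewrite /lo permK.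
- by move=> q; rewrite /lo /= permK.
- move=> q; exists (pi q); rewrite /lo /= permK leqnn ltnSn; split=> //.
  move=> q' h; congr cT; apply: val_inj; apply/eqP.
  by rewrite eqn_leq -ltnS andbC.
- move=> q; rewrite /cT /=; congr (inl (blk _)).
  by apply: val_inj; rewrite /= !lP !permK half_partner.
by exists.
Qed.

End Proximate.

(** * Edge contraction and semigroup evaluation gather all tokens in one place *)

Section Gathered.
Local Open Scope nat_scope.
Variables (A E : Type) (N M B P : nat).
Variable sem : E -> cache_content A M -> cache_content A M.
Variables (lo hi : A -> nat) (ok Q : A -> Prop).
Variables (x : 'I_N -> A) (pi : {perm 'I_N}).

(** The clause 0 < T serves inputs with few blocks, where [perm_bound] is at most a constant. *)
Definition gathers (T : nat) : Prop :=
  1 < N -> 0 < T /\ exists (S : schedule M B P pi T) y, forall i, loc S T i = y.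

Lemma gathering_run (pr : program E P M B) b k z :
  interval_sem sem lo hi ok Q -> 0 < B -> (forall i, Q (x i)) ->
  (forall q, lo (x (pi q)) = q) -> (forall q, hi (x (pi q)) = q.+1) ->
  crew pr -> shared (run sem (initial P M B x) pr) b k = Some z ->
  ok z -> lo z = 0 -> hi z = N -> gathers (size pr).
Proof.
move=> semP B0 xQ lox hix cr cz okz loz hiz N1.
(* The output atom covers every position, so a constant trace works. *)
pose cT (q : 'I_N) : cell M B P := inl (b, k).
have tr : traced lo hi ok (run sem (initial P M B x) pr) cT.
  move=> q; exists z; split=> //.
  by rewrite loz hiz leq0n ltn_ord.
split.
  case: pr cr cz tr => //= _ cz _.
  have [i [Ez _]] := @initialP A N M B P x B0 (inl (b, k)) z cz.
  have [El Eh] := @lo_hi_x A N lo hi x pi lox hix i.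
  by move: loz hiz N1; rewrite Ez El Eh => -> <-.
have [//|S SP] := @schedule_of_run A E N M B P sem lo hi ok Q semP x pi
  B0 xQ lox hix pr cT cr tr.
by exists S, (inl b) => i; rewrite SP.
Qed.

End Gathered.

Section Edges.
Local Open Scope nat_scope.
Variables N M B P : nat.

(** An edge (u,v) is the interval from u to v, contraction joins adjacent intervals, and the
    invariant keeps the end points ordered. *)
Lemma edge_interval_sem :
  interval_sem (@edge_sem M) fst snd (fun=> True) (fun e => e.1 < e.2).
Proof.
move=> [i j] c cQ k z /=.
have old : c k = Some z -> z.1 < z.2 /\ ((exists k', c k' = Some z) \/
    exists i j x y, [/\ c i = Some x, c j = Some y &
      True -> concatenates fst snd (fun=> True) z x y]).
  by move=> ck; split; [exact: cQ ck|left; exists k].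
case ci: (c i) => [[u v]|]; last by move/old.
case cj: (c j) => [[v' w]|]; last by move/old.
case: eqP => [Ev|_]; last by move/old.
subst v'; rewrite ffunE; case: eqP => [_ [<-]|_].
  have uv := cQ _ _ ci; have vw := cQ _ _ cj; rewrite /= in uv vw *.
  split; first exact: ltn_trans vw.
  right; exists i, j, (u, v), (v, w); split=> // _.
  by split=> //; split; exact: ltnW.
by rewrite ffunE; case: eqP => // _; exact: old.
Qed.

(** The inverse appears because [path_edge] sends cells to positions and schedules use the opposite
    direction. *)
Lemma edges_gather (pi : {perm 'I_N}) (pr : program (edge_op M) P M B) :
  0 < B -> solves_edges (pi^-1)%g pr -> gathers M B P pi (size pr).
Proof.
move=> B0 [cr [b [k sol]]].
apply: (gathering_run edge_interval_sem B0 _ _ _ cr sol) => // q.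
- by rewrite /= permK.
- by rewrite /= permK.
Qed.

End Edges.

Section Words.
Variable N : nat.

(** Words under concatenation are the hard semigroup: a product of letters reveals its factors and
    their order. *)
Definition word : Type := seq 'I_N.
HB.instance Definition _ := Choice.on word.
HB.instance Definition _ := isSemigroup.Build word (@catA 'I_N).

End Words.

Section Semigroups.
Local Open Scope nat_scope.
Variables (N M B P : nat) (pi : {perm 'I_N}).

Definition positions (w : word N) : seq nat :=
  [seq nat_of_ord ((pi^-1)%g i) | i <- w].

Definition word_lo (w : word N) : nat := head 0 (positions w).
Definition word_hi (w : word N) : nat := word_lo w + size w.

Definition factor (w : word N) : Prop := positions w = iota (word_lo w) (size w).

(** Products in a wrong order may be formed, so being an interval is no invariant; it is inherited
    backwards instead, as factors of a word with consecutive positions have consecutive positions.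
    Nonemptiness makes [word_lo] meaningful. *)
Lemma semigroup_interval_sem :
  interval_sem (@semigroup_sem (word N) M) word_lo word_hi factor
    (fun w => w <> [::]).
Proof.
move=> [[i j] k0] c cQ k z /=.
have old : c k = Some z -> z <> [::] /\ ((exists k', c k' = Some z) \/
    exists i j x y, [/\ c i = Some x, c j = Some y &
      factor z -> concatenates word_lo word_hi factor z x y]).
  by move=> ck; split; [exact: cQ ck|left; exists k].
case ci: (c i) => [u|]; last by move/old.
case cj: (c j) => [v|]; last by move/old.
rewrite ffunE; case: eqP => [_ [<-]|_]; last exact: old.
have u0 := cQ _ _ ci; have v0 := cQ _ _ cj.
have Euv : (u * v)%g = u ++ v by [].
rewrite Euv; split; first by case: (u) u0.
right; exists i, j, u, v; split=> //.
rewrite /factor {1}/positions map_cat size_cat iotaD => /eqP.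
rewrite eqseq_cat ?size_map ?size_iota // => /andP[/eqP Eu /eqP Ev].
have lu : word_lo u = word_lo (u ++ v).
  by rewrite {1}/word_lo /positions Eu; case: (u) u0.
have lv : word_lo v = word_lo (u ++ v) + size u.
  by rewrite {1}/word_lo /positions Ev; case: (v) v0.
split.
- by rewrite /factor /positions Eu lu.
- by rewrite /factor /positions Ev lv.
- by rewrite lv /word_hi lu.
- by rewrite /word_hi lv size_cat addnA.
by rewrite /word_hi !leq_addr.
Qed.

Lemma sg_prod_letters (s : seq 'I_N) :
  s <> [::] -> sg_prod [seq ([:: i] : word N) | i <- s] = Some (s : word N).
Proof.
case: s => // i s _ /=; congr Some.
rewrite -[RHS]cat1s; move: [:: i] => w.
elim: s w => [|j s IH] w /=; first by rewrite cats0.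
by rewrite IH -cat_rcons -cats1.
Qed.

Lemma semigroup_gathers (pr : program (semigroup_op M) P M B) :
  0 < B -> solves_semigroup pi (fun i => [:: i] : word N) pr ->
  gathers M B P pi (size pr).
Proof.
move=> B0 [cr [b [k [z sol prod]]]] N1.
have Ez : z = [seq pi i | i <- enum 'I_N].
  move: prod; rewrite (map_comp (fun i => [:: i] : word N) pi).
  rewrite sg_prod_letters; first by case.
  by move/(congr1 size); rewrite size_map size_enum_ord => N0; rewrite N0 in N1.
have posz : positions z = iota 0 N.
  rewrite -val_enum_ord Ez /positions -map_comp; apply: eq_map => i /=.
  by rewrite permK.
have szz : size z = N by rewrite Ez size_map size_enum_ord.
have loz : word_lo z = 0 by rewrite /word_lo posz; case: (N).
apply: (gathering_run semigroup_interval_sem B0 _ _ _ cr sol) => // [q|q||].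
- by rewrite /word_lo /= permK.
- by rewrite /word_hi /word_lo /= permK addn1.
- by rewrite /factor loz szz.
- by rewrite /word_hi loz szz.
Qed.

End Semigroups.

(** * Blind algorithms *)

Section Blind.
Local Open Scope nat_scope.
Variables N M B P : nat.
Hypothesis B_gt0 : 0 < B.

Local Notation aprogram := (program void P M B).

Definition config_at (pr : aprogram) (t : nat) : config 'I_N P M B :=
  run_atomic N (take t pr).
Definition round_at (pr : aprogram) (t : nat) : round void P M B :=
  nth (idle_round void P M B) pr t.

Lemma run_idle_round (cf : config 'I_N P M B) :
  run_round (@atomic_sem 'I_N M) cf (idle_round void P M B) = cf.
Proof.
case: cf => sh ca; rewrite /run_round /=; congr Config; apply/funext => b.
  by case: pickP => // p; rewrite ffunE.
by rewrite ffunE.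
Qed.

Lemma config_at_step pr t :
  config_at pr t.+1 = run_round (@atomic_sem 'I_N M) (config_at pr t) (round_at pr t).
Proof.
rewrite /config_at /round_at; have [tp|tp] := ltnP t (size pr).
  by rewrite (take_nth (idle_round void P M B)) // /run_atomic /run foldl_rcons.
by rewrite nth_default // run_idle_round !take_oversize // (leq_trans tp).
Qed.

Definition held (pr : aprogram) (t : nat) (p : 'I_P) (i : 'I_N) : Prop :=
  exists m, cache (config_at pr t) p m = Some i.

Definition arrival (pr : aprogram) (s : nat) (p : 'I_P) (k : 'I_B) : option 'I_N :=
  if read_block (round_at pr s) p is Some b then shared (config_at pr s) b k
  else None.

Lemma held_after_local pr t p m i :
  after_local (@atomic_sem 'I_N M) (config_at pr t) (round_at pr t) p m = Some i ->
  held pr t p i.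
Proof.
have noop : interval_sem (@atomic_sem 'I_N M) id id (fun=> True) (held pr t p) by case.
by apply: (run_locals_inv noop) => k a ck; exists k.
Qed.

(** Caches start empty and no atom is created, so a held atom was read earlier; the round and the
    cell of the block will name it. *)
Lemma held_arrival pr t p i : held pr t p i ->
  exists s k, s < t /\ arrival pr s p k = Some i.
Proof.
elim: t => [|t IH] [m].
  by rewrite /config_at take0 ffunE.
rewrite config_at_step => h.
have := @round_originP _ _ M B P (@atomic_sem 'I_N M) _ _ (inr (p, m)) i h.
move E: (inr (p, m)) => x o; case: o E => //.
  move=> p' m' + [Ep _]; rewrite -Ep => /held_after_local/IH[s [k [st a]]].
  by exists s, k; rewrite ltnS ltnW.
move=> p' m' b k + + [Ep _]; rewrite -Ep => rb sb.
by exists t, k; rewrite ltnSn /arrival rb.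
Qed.

(** A block is either still the input block or was last written by a single processor, which then
    held both atoms. *)
Lemma shared_pair pr t b k k' i j : crew pr ->
  shared (config_at pr t) b k = Some i -> shared (config_at pr t) b k' = Some j ->
  i %/ B = j %/ B \/
  exists s p, [/\ s < t, s < size pr, held pr s p i & held pr s p j].
Proof.
move=> cr; elim: t b k k' => [|t IH] b k k'.
  rewrite /config_at take0 => hi hj; left.
  have [i' [[->] Ei]] := @initialP 'I_N N M B P id B_gt0 (inl (b, k)) i hi.
  have [j' [[->] Ej]] := @initialP 'I_N N M B P id B_gt0 (inl (b, k')) j hj.
  by case: Ei => <-; case: Ej => <-.
rewrite config_at_step => hi hj.
have := @round_originP _ _ M B P (@atomic_sem 'I_N M) _ _ (inl (b, k)) i hi.
have := @round_originP _ _ M B P (@atomic_sem 'I_N M) _ _ (inl (b, k')) j hj.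
move Ej: (inl (b, k')) => y oj; move Ei: (inl (b, k)) => x oi.
case: oj Ej => [//|//|b1 k1 p m wp cp|b1 k1 nw sj] [Eb Ek]; subst b1 k1;
  case: oi Ei => [//|//|b2 k2 p' m' wp' cp'|b2 k2 nw' si] [Eb Ek]; subst b2 k2.
- right; exists t, p.
  have tp : t < size pr.
    by rewrite ltnNge; apply/negP => tp; move: wp; rewrite /round_at nth_default // /write_block ffunE.
  have Ep : p' = p by exact: cr tp p' p b (write_blockP wp') (write_blockP wp).
  split=> //; last exact: held_after_local cp.
  by rewrite -Ep; exact: held_after_local cp'.
- by case: (nw' p).
- by case: (nw p').
have [->|[s [p [st sp h1 h2]]]] := IH b k k' si sj; first by left.
by right; exists s, p; rewrite ltnS ltnW.
Qed.

Variable T : nat.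

(** Either the pair shares an input block, named by one atom and an offset, or a processor and two
    of its reads bring the pair together. *)
Definition pair_key : finType :=
  ('I_N * 'I_B + 'I_P * (('I_T * 'I_B) * ('I_T * 'I_B)))%type.

(* The last clause makes a pair decodable from the run before any view shows
   that its labels are equal. *)
Definition keys (pr : aprogram) (u v : 'I_N) (c : pair_key) : Prop :=
  match c with
  | inl (i, k) => u = i /\ v = i %/ B * B + k :> nat
  | inr (p, ((s, k), (s', k'))) =>
      [/\ arrival pr s p k = Some u, arrival pr s' p k' = Some v
        & forall t q, held pr t q u -> held pr t q v -> s < t /\ s' < t]
  end.

Lemma keys_exist pr b k k' u v : crew pr -> size pr <= T ->
  shared (run_atomic N pr) b k = Some u -> shared (run_atomic N pr) b k' = Some v ->
  exists c, keys pr u v c.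
Proof.
move=> cr pT hu hv.
have hu' : shared (config_at pr (size pr)) b k = Some u by rewrite /config_at take_size.
have hv' : shared (config_at pr (size pr)) b k' = Some v by rewrite /config_at take_size.
have [E|[s0 [p0 [s0t _ hu0 hv0]]]] := shared_pair cr hu' hv'.
  exists (inl (u, Ordinal (ltn_pmod v B_gt0))); split=> //=.
  by rewrite E -divn_eq.
pose met t := `[< exists p, held pr t p u /\ held pr t p v >].
(* Taking the earliest meeting ensures that both reads precede every time at which the pair is held
   together. *)
have [|t /asboolP[p [pu pv]] tmin] := ex_minnP (P := met).
  by exists s0; apply/asboolP; exists p0.
have tT : t <= T.
  apply: leq_trans (_ : s0 <= _); last by rewrite ltnW // (leq_trans s0t).
  by apply: tmin; apply/asboolP; exists p0.
have [s [l [st al]]] := held_arrival pu.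
have [s' [l' [st' al']]] := held_arrival pv.
exists (inr (p, ((Ordinal (leq_trans st tT), l), (Ordinal (leq_trans st' tT), l')))).
split=> //= t' q qu qv.
have tt' : t <= t' by apply: tmin; apply/asboolP; exists q.
by rewrite (leq_trans st) // (leq_trans st').
Qed.

Variable D : labeling N -> aprogram.
Hypothesis D_blind : blind D.

Section Injectivity.
Variables (pi1 pi2 : {perm 'I_N}) (l1 l2 : labeling N).
Hypotheses (l1P : labels_positions pi1 l1) (l2P : labels_positions pi2 l2).
Variable c : 'I_N./2 -> pair_key.
Hypothesis key1 :
  forall a, keys (D l1) (pi1 (pair_fst a)) (pi1 (pair_snd a)) (c a).
Hypothesis key2 :
  forall a, keys (D l2) (pi2 (pair_fst a)) (pi2 (pair_snd a)) (c a).

Definition same_run (t : nat) : Prop :=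
  (forall s, s <= t -> config_at (D l1) s = config_at (D l2) s) /\
  (forall s, s < t -> round_at (D l1) s = round_at (D l2) s).

Lemma same_run_arrival t s p k : same_run t -> s < t ->
  arrival (D l1) s p k = arrival (D l2) s p k.
Proof. by move=> [Ec Er] st; rewrite /arrival Ec ?Er // ltnW. Qed.

Lemma key_decode t a : same_run t ->
  (forall p k, c a = inr (p, k) -> k.1.1 < t /\ k.2.1 < t) ->
  pi1 (pair_fst a) = pi2 (pair_fst a) /\ pi1 (pair_snd a) = pi2 (pair_snd a).
Proof.
move=> sr early; have := key1 a; have := key2 a; move: early.
case: (c a) => [[i k] _|[p [[s k] [s' k']]] early] /=.
  by move=> [-> E2] [-> E1]; split=> //; apply: val_inj; rewrite /= E1 E2.
have [st st'] := early p _ erefl.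
move=> [a2 a2' _] [a1 a1' _]; split.
  by move: a1; rewrite (same_run_arrival p k sr st) a2 => -[].
by move: a1'; rewrite (same_run_arrival p k' sr st') a2' => -[].
Qed.

End Injectivity.

Lemma label_fst (pi : {perm 'I_N}) l a :
  labels_positions pi l -> label l (pi (pair_fst a)) = a.
Proof. by move=> lP; apply: val_inj; rewrite /= lP permK /= doubleK. Qed.

Lemma label_snd (pi : {perm 'I_N}) l a :
  labels_positions pi l -> label l (pi (pair_snd a)) = a.
Proof. by move=> lP; apply: val_inj; rewrite /= lP permK /= uphalf_double. Qed.

Lemma label_pair (pi : {perm 'I_N}) l i : labels_positions pi l ->
  i = pi (pair_fst (label l i)) \/ i = pi (pair_snd (label l i)).
Proof.
move=> lP; have E := lP i.
case: (boolP (odd ((pi^-1)%g i))) => o; [right|left];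
  rewrite -[LHS](permKV pi); congr (pi _); apply: val_inj => /=; rewrite E; lia.
Qed.

(** If a view shows equal labels, both reads in the key of that pair lie in the past, where the runs
    coincide; so the key names the same pair for the other permutation. *)
Lemma view_label (pi1 pi2 : {perm 'I_N}) l1 l2 c t p i j :
  labels_positions pi1 l1 -> labels_positions pi2 l2 ->
  (forall a, keys (D l1) (pi1 (pair_fst a)) (pi1 (pair_snd a)) (c a)) ->
  (forall a, keys (D l2) (pi2 (pair_fst a)) (pi2 (pair_snd a)) (c a)) ->
  same_run l1 l2 t -> held (D l1) t p i -> held (D l1) t p j ->
  label l1 i = label l1 j -> label l2 i = label l2 j.
Proof.
move=> l1P l2P key1 key2 sr hi hj Eij.
have [-> //|nij] := eqVneq i j.
have [a Ea] : exists a, a = label l1 i by exists (label l1 i).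
have met : held (D l1) t p (pi1 (pair_fst a)) /\ held (D l1) t p (pi1 (pair_snd a)).
  have := label_pair i l1P; have := label_pair j l1P; rewrite -Eij -Ea.
  move=> [Ej|Ej] [Ei|Ei]; try by move: nij; rewrite Ei Ej eqxx.
  - by rewrite -Ej -Ei.
  - by rewrite -Ej -Ei.
have [Ef Es] : pi1 (pair_fst a) = pi2 (pair_fst a) /\ pi1 (pair_snd a) = pi2 (pair_snd a).
  apply: (key_decode key1 key2 sr) => q [[s k] [s' k']] Ec /=.
  have := key1 a; rewrite Ec => -[_ _ h]; exact: h met.1 met.2.
have la k : k = pi1 (pair_fst a) \/ k = pi1 (pair_snd a) -> label l2 k = a.
  by move=> [->|->]; rewrite ?Ef ?Es ?label_fst ?label_snd.
rewrite !la //; first by have := label_pair j l1P; rewrite -Eij -Ea.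
by have := label_pair i l1P; rewrite -Ea.
Qed.

Lemma same_run_sym l1 l2 t : same_run l1 l2 t -> same_run l2 l1 t.
Proof. by move=> [Ec Er]; split=> s st; rewrite ?Ec ?Er. Qed.

(** Equal runs so far give equal views by [view_label], used in both directions, and blindness gives
    equal next rounds. Once the runs coincide, all keys decode alike. *)
Lemma keys_inj (pi1 pi2 : {perm 'I_N}) l1 l2 c :
  labels_positions pi1 l1 -> labels_positions pi2 l2 ->
  (forall a, keys (D l1) (pi1 (pair_fst a)) (pi1 (pair_snd a)) (c a)) ->
  (forall a, keys (D l2) (pi2 (pair_fst a)) (pi2 (pair_snd a)) (c a)) ->
  pi1 = pi2.
Proof.
move=> l1P l2P key1 key2.
have sr t : same_run l1 l2 t.
  elim: t => [|t sr].
    by split=> // s; rewrite leqn0 => /eqP ->; rewrite /config_at !take0.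
  have [Ec Er] := sr.
  have Et : round_at (D l1) t = round_at (D l2) t.
    apply: D_blind => s st; rewrite -!/(config_at _ _) => p.
    have Es := Ec s st; split; first by rewrite Es.
    have srs : same_run l1 l2 s.
      split=> s' h; first by apply: Ec; exact: leq_trans h st.
      by apply: Er; exact: leq_trans h st.
    move=> m m' i j ci cj.
    have h1 : held (D l1) s p i by exists m.
    have h1' : held (D l1) s p j by exists m'.
    have h2 : held (D l2) s p i by exists m; rewrite -Es.
    have h2' : held (D l2) s p j by exists m'; rewrite -Es.
    apply/eqP/eqP; first exact: view_label l1P l2P key1 key2 srs h1 h1'.
    exact: view_label l2P l1P key2 key1 (same_run_sym srs) h2 h2'.
  split=> s; rewrite ?ltnS leq_eqVlt => /predU1P[->|st].
  - by rewrite !config_at_step Ec // Et.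
  - exact: Ec.
  - exact: Et.
  - exact: Er.
have dec a := key_decode key1 key2 (sr T) (a := a).
have {}dec a : pi1 (pair_fst a) = pi2 (pair_fst a) /\ pi1 (pair_snd a) = pi2 (pair_snd a).
  by apply: dec => p [[s k] [s' k']] _; split; exact: ltn_ord.
by apply: perm_eq_on_pairs => a; have [] := dec a.
Qed.

Lemma card_blind_solved (L : {perm 'I_N} -> labeling N) (F : {set {perm 'I_N}}) :
  (forall pi, labels_positions pi (L pi)) ->
  (forall pi, pi \in F -> solves_proximate (L pi) (D (L pi)) /\ size (D (L pi)) <= T) ->
  #|F| <= (N * B + P * (T * B * (T * B))) ^ N./2.
Proof.
move=> LP FP.
have ex pi : pi \in F -> exists c : {ffun 'I_N./2 -> pair_key}, forall a,
    keys (D (L pi)) (pi (pair_fst a)) (pi (pair_snd a)) (c a).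
  move=> /FP[[cr sol] pT].
  have [c cP] : {c : 'I_N./2 -> pair_key & forall a,
      keys (D (L pi)) (pi (pair_fst a)) (pi (pair_snd a)) (c a)}.
    apply: (@choice _ _ (fun a => keys (D (L pi)) (pi (pair_fst a)) (pi (pair_snd a)))) => a.
    have [b bP] := sol a.
    have [k ck] := bP _ (label_fst a (LP pi)).
    have [k' ck'] := bP _ (label_snd a (LP pi)).
    exact: keys_exist cr pT ck ck'.
  by exists [ffun a => c a] => a; rewrite ffunE.
have [-> |[pi0 pi0F]] := set_0Vmem F; first by rewrite cards0.
have [c0 _] := ex _ pi0F.
have [f fP] : {f : {perm 'I_N} -> {ffun 'I_N./2 -> pair_key} & forall pi, pi \in F ->
    forall a, keys (D (L pi)) (pi (pair_fst a)) (pi (pair_snd a)) (f pi a)}.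
  apply: (@choice _ _ (fun (pi : {perm 'I_N}) (c : {ffun 'I_N./2 -> pair_key}) => pi \in F ->
    forall a, keys (D (L pi)) (pi (pair_fst a)) (pi (pair_snd a)) (c a))) => pi.
  have [/ex[c cP]|nF] := boolP (pi \in F); first by exists c.
  by exists c0.
have f_inj : {in F &, injective f}.
  move=> pi1 pi2 F1 F2 E; apply: (keys_inj (LP pi1) (LP pi2) (fP _ F1)).
  by rewrite E; exact: fP.
rewrite -(card_in_imset f_inj); apply: leq_trans (max_card _) _.
by rewrite card_ffun card_sum !card_prod !card_ord.
Qed.

End Blind.

(** * Padding schedules with idle rounds *)

Section Extension.
Local Open Scope nat_scope.
Variables N M B P : nat.

Lemma schedule_le (pi : {perm 'I_N}) T T' : T <= T' ->
  inhabited (schedule M B P pi T) -> inhabited (schedule M B P pi T').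
Proof.
move=> TT' [S]; constructor.
pose rd' t p := if t < T then rd S t p else None.
pose wr' t p := if t < T then wr S t p else None.
apply: (@Schedule N M B P pi T' (fun t => loc S (minn t T)) rd' wr').
- by move=> i; rewrite min0n loc0.
- by move=> t p q b; rewrite /wr'; case: ifP => // _; exact: wr_excl.
- move=> t i _; rewrite /rd' /wr' /=; case: ltnP => tT.
    by rewrite (minn_idPl tT); exact: loc_move.
  rewrite (minn_idPr (leqW tT)) /legal_move.
  by case: (loc S T i).
- by move=> t y _; apply: loc_capacity; exact: geq_minr.
- by move=> i; rewrite (minn_idPr TT'); exact: loc_end.
Qed.

End Extension.

(** * Hard permutations for all three problems *)

Section Hardness.
Variable R : realType.
Variables N M B P : nat.
Hypotheses (B_gt0 : (0 < B)%N) (P_gt0 : (0 < P)%N) (PB_le_N : (P * B <= N)%N).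

Let perm := perm_bound R P N M B.
Let B0R : 0 < (B%:R : R). Proof. by rewrite ltr0n. Qed.
Let P0R : 0 < (P%:R : R). Proof. by rewrite ltr0n. Qed.
Let P1R : 1 <= (P%:R : R). Proof. by rewrite ler1n. Qed.
Let PB0 : 0 < (P%:R * B%:R : R). Proof. by rewrite mulr_gt0. Qed.
Let r_ge1 : 1 <= (N%:R / (P%:R * B%:R) : R).
Proof. by rewrite ler_pdivlMr // mul1r -natrM ler_nat. Qed.
Let d_ge2 : 2 <= fan_out R P N M B.
Proof. by rewrite /fan_out le_max lexx. Qed.
Let NB_E : N%:R / B%:R = N%:R / (P%:R * B%:R) * P%:R :> R.
Proof. by field; rewrite !gt_eqF. Qed.
Let P_le_NB : P%:R <= N%:R / B%:R :> R.
Proof. by rewrite NB_E ler_peMl // ltW. Qed.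
Let NB0 : 0 < (N%:R / B%:R : R).
Proof. exact: lt_le_trans P0R P_le_NB. Qed.

Lemma log2_ge0 : 0 <= log2 (P%:R : R).
Proof. by rewrite /log2 divr_ge0 ?ln_ge0 // ler1n. Qed.

Lemma perm_bound_ge0 : 0 <= perm.
Proof.
rewrite /perm /perm_bound le_min divr_ge0 //= mulr_ge0 ?divr_ge0 ?(ltW PB0) //.
by rewrite /olog le_max ler01.
Qed.

(** With r = N/(P B), the quotient r / ln d is at least 1 / ln 2, so the second term of [perm_bound]
    is at least log2(N/B) >= log2 P. *)
Lemma min_log2_le_perm_bound : Num.min (N%:R / P%:R) (log2 P%:R) <= perm.
Proof.
rewrite /perm /perm_bound -/(fan_out R P N M B) le_min ge_min lexx /=.
rewrite ge_min; apply/orP; right.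
set r := N%:R / (P%:R * B%:R); set d := fan_out R P N M B.
have r0 : 0 < r by apply: lt_le_trans r_ge1.
have ln2 : 2^-1 <= ln (2 : R) by exact: ln_ge_half.
have ln21 : ln (2 : R) <= 2 - 1 by apply: ln_le_subr1.
have d0 : 0 < d by apply: lt_le_trans d_ge2.
have lnd : 2^-1 <= ln d by exact: ln_ge_half.
(* Since d <= max(2, r), it suffices that ln r <= ln 2 + r/2 - 1 <= r ln 2, using ln 2 >= 1/2. *)
have lndr : ln d <= r * ln 2.
  have : d <= Num.max 2 r.
    by rewrite /d /fan_out -/r ge_max !le_max lexx /= !ge_min (lexx r) !orbT.
  rewrite le_max => /orP[d2|dr].
    apply: (@le_trans _ _ (ln 2)); first by rewrite ler_ln ?posrE.
    by rewrite ler_peMl //; lra.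
  have : ln d <= ln r by rewrite ler_ln ?posrE.
  have : ln (r / 2) <= r / 2 - 1 by apply: ln_le_subr1; rewrite divr_gt0.
  rewrite ln_div ?posrE //.
  have : 0 <= (r - 1) * (ln 2 - 2^-1) by rewrite mulr_ge0 // subr_ge0.
  lra.
apply: (@le_trans _ _ (r * (ln (N%:R / B%:R) / ln d))); last first.
  by rewrite ler_wpM2l ?(ltW r0) // /olog le_max lexx orbT.
have lnP : 0 <= ln (P%:R : R) by rewrite ln_ge0.
have lnPN : ln (P%:R : R) <= ln (N%:R / B%:R) by rewrite ler_ln ?posrE.
rewrite /log2 ler_pdivrMr; last by lra.
rewrite mulrA mulrAC ler_pdivlMr; last by lra.
apply: (@le_trans _ _ (ln (N%:R / B%:R) * (r * ln 2))); last by lra.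
by apply: ler_pM => //; lra.
Qed.

(** The factor 32 is 16 divided by the lower bound 1/2 for ln d. *)
Lemma perm_bound_small : ln (N%:R / B%:R : R) <= 16 -> perm <= 32 * expR 16.
Proof.
move=> L16; rewrite /perm /perm_bound -/(fan_out R P N M B) ge_min.
apply/orP; right.
have lnd : 2^-1 <= ln (fan_out R P N M B) by exact: ln_ge_half.
have e16 : N%:R / B%:R <= expR 16 :> R by rewrite -[leLHS]lnK // ler_expR.
rewrite [leRHS]mulrC; apply: ler_pM.
- exact: le_trans r_ge1.
- by rewrite /olog le_max ler01.
- by apply: le_trans e16; rewrite NB_E ler_peMr // (le_trans _ r_ge1).
rewrite /olog ge_max; apply/andP; split; first by rewrite ler1n.
by rewrite ler_pdivrMr; lra.
Qed.

(** Otherwise every permutation has a short schedule; padding all to the longest contradicts the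
    counting bound. *)
Lemma hard_permutation : 16 <= ln (N%:R / B%:R : R) ->
  exists pi : {perm 'I_N}, forall T,
    inhabited (schedule M B P pi T) -> perm <= 208 * T%:R.
Proof.
move=> L16; apply: contrapT => /forallNP easy.
have [f fP] : {f : {perm 'I_N} -> nat & forall pi,
    inhabited (schedule M B P pi (f pi)) /\ 208 * (f pi)%:R < perm}.
  apply: (@choice _ _ (fun (pi : {perm 'I_N}) T =>
    inhabited (schedule M B P pi T) /\ 208 * T%:R < perm)) => pi.
  have /existsNP[T /not_implyP[S /negP]] := easy pi.
  by rewrite -ltNge => h; exists T.
have [|pi0 Emax] := @bigop.eq_bigmax _ f; first by rewrite card_Sn fact_gt0.
have scheds (pi : {perm 'I_N}) : inhabited (schedule M B P pi (f pi0)).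
  by apply: schedule_le _ (fP pi).1; rewrite -Emax bigop.leq_bigmax.
have := perm_bound_le_length B_gt0 P_gt0 PB_le_N scheds L16.
by rewrite -/perm leNgt (fP pi0).2.
Qed.

(* 208 covers the counting bound, [expR 16] the inputs with few blocks. *)
Definition hard_const : R := (208 * expR 16)^-1.

Lemma hard_const_gt0 : 0 < hard_const.
Proof. by rewrite invr_gt0 mulr_gt0 ?expR_gt0. Qed.

Lemma hard_const_le (x : R) : perm <= 208 * x -> hard_const * perm <= x.
Proof.
move=> h; have e1 : 1 <= expR (16 : R) by rewrite -expR0 ler_expR.
rewrite /hard_const mulrC ler_pdivrMr; last by rewrite mulr_gt0 ?expR_gt0.
have p0 := perm_bound_ge0.
have : 0 <= x * (expR 16 - 1) by rewrite mulr_ge0 ?subr_ge0 //; lra.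
lra.
Qed.

Lemma hard_const_small (T : nat) :
  ln (N%:R / B%:R : R) <= 16 -> (0 < T)%N -> hard_const * perm <= T%:R.
Proof.
move=> /perm_bound_small h T0; apply: (@le_trans _ _ 1); last by rewrite ler1n.
rewrite /hard_const mulrC ler_pdivrMr; last by rewrite mulr_gt0 ?expR_gt0.
have : 0 < expR (16 : R) by exact: expR_gt0.
lra.
Qed.

Lemma hard_proximate : (B < N)%N -> exists pi : {perm 'I_N}, forall T,
  inhabited (schedule M B P pi T) -> hard_const * perm <= T%:R.
Proof.
move=> BN; have [L16|L16] := leP 16 (ln (N%:R / B%:R : R)).
  have [pi piP] := hard_permutation L16.
  by exists pi => T /piP; exact: hard_const_le.
have N1 : (1 < N)%N by apply: leq_trans BN; rewrite ltnS.
have N0 : (0 < N)%N by apply: ltnW.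
have ltl : (N.-1 < N)%N by rewrite ltn_predL.
pose q0 := Ordinal N0; pose q1 := Ordinal N1; pose ql := Ordinal ltl.
(* Positions 0 and 1 are put into the first and last cell, which lie in different blocks as B < N,
   so zero rounds do not suffice. *)
exists (tperm q1 ql) => T [S]; apply: hard_const_small; first exact: ltW.
case: T S => // S; have := loc_end S (tperm q1 ql q0).
rewrite !loc0 /mate permK.
have -> : partner q0 = q1 by apply: val_inj; rewrite val_insubd /= N1.
have -> : tperm q1 ql q0 = q0.
  by rewrite tpermD // -val_eqE /=; lia.
rewrite tpermL /= div0n => -[] /esym/eqP.
by rewrite -leqn0 leqNgt divn_gt0 // -ltnS prednK // BN.
Qed.

Lemma hard_gather : (1 < N)%N -> exists pi : {perm 'I_N}, forall T,
  gathers M B P pi T -> hard_const * perm <= T%:R /\ log2 P%:R <= T%:R :> R.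
Proof.
move=> N1.
have logP (pi : {perm 'I_N}) T : gathers M B P pi T -> log2 P%:R <= T%:R :> R.
  move=> /(_ N1)[_ [S [y Sy]]].
  have NT := gathered_length B_gt0 Sy.
  have PT : (P <= 2 ^ T)%N.
    by rewrite -(leq_pmul2r B_gt0) (leq_trans PB_le_N) // mulnC.
  have ln2 : 0 < ln (2 : R) by apply: lt_le_trans (ln_ge_half _).
  rewrite /log2 ler_pdivrMr // mulr_natl -lnXn // -natrX.
  by rewrite ler_ln ?posrE ?ltr0n ?expn_gt0 // ler_nat.
have [L16|L16] := leP 16 (ln (N%:R / B%:R : R)).
  have [pi piP] := hard_permutation L16.
  exists pi => T gT; split; last exact: logP gT.
  by apply: hard_const_le; apply: piP; have [_ [S _]] := gT N1.
exists 1%g => T gT; split; last exact: logP gT.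
by apply: hard_const_small; [exact: ltW|have [] := gT N1].
Qed.

End Hardness.

(** * Few permutations are solved fast by a blind algorithm *)

Section FewFastBlind.
Variable R : realType.

Lemma cubic_le_exp2 (k : nat) : (20 <= k)%N ->
  64 * (k%:R + k%:R ^+ 3) <= 2 ^+ k :> R.
Proof.
move=> k20; rewrite -(subnKC k20); elim: (k - 20)%N => [|j IH].
  by rewrite addn0; lra.
rewrite addnS [leRHS]exprS -[(20 + j).+1%:R]natr1.
have x20 : 20 <= (20 + j)%N%:R :> R by rewrite ler_nat leq_addr.
move: ((20 + j)%N%:R : R) x20 IH => x x20 IH.
apply: le_trans (_ : 2 * (64 * (x + x ^+ 3)) <= _); last by rewrite ler_wpM2l.
have : 0 <= x * (x - 20) * x by rewrite !mulr_ge0 //; lra.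
have : 0 <= x * (x - 20) by rewrite !mulr_ge0 //; lra.
lra.
Qed.

(** N/P <= log2 P forces B and T below k, the integer part of log2 N. A key then has at most N(k +
    k^3) <= N^2/64 values, and N/2 keys have at most (N/8)^N, less than half of N!. The threshold
    2^20 comes from [cubic_le_exp2]. *)
Lemma few_blind_solved (N B P T : nat) :
  (2 ^ 20 <= N)%N -> ~~ odd N -> (0 < B)%N -> (0 < P)%N -> (P * B <= N)%N ->
  N%:R / P%:R <= log2 P%:R :> R -> T%:R <= log2 P%:R :> R ->
  (2 * (N * B + P * (T * B * (T * B))) ^ N./2 <= N`!)%N.
Proof.
move=> N20 eN B0 P0 PBN NP TP.
set k := trunc_log 2 N.
have N0 : (0 < N)%N by apply: leq_trans N20; rewrite expn_gt0.
have k20 : (20 <= k)%N by exact: trunc_log_max.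
have Nk : (2 ^ k <= N)%N by exact: trunc_logP.
have Nk1 : (N < 2 ^ k.+1)%N by exact: trunc_log_ltn.
have B0R : 0 < (B%:R : R) by rewrite ltr0n.
have P0R : 0 < (P%:R : R) by rewrite ltr0n.
have ln2 : 2^-1 <= ln (2 : R) by exact: ln_ge_half.
have PN : (P <= N)%N by apply: leq_trans PBN; rewrite leq_pmulr.
have logk : log2 P%:R < k.+1%:R :> R.
  rewrite /log2 ltr_pdivrMr; last by lra.
  rewrite mulr_natl -lnXn // -natrX ltr_ln ?posrE ?ltr0n ?expn_gt0 //.
  by rewrite ltr_nat (leq_ltn_trans PN).
have Tk : (T <= k)%N by rewrite -ltnS -(ltr_nat R) (le_lt_trans TP).
have Bk : (B <= k)%N.
  rewrite -ltnS -(ltr_nat R); apply: le_lt_trans logk; apply: le_trans NP.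
  by rewrite ler_pdivlMr // -natrM ler_nat mulnC.
have step : (N * B + P * (T * B * (T * B)) <= N * (k + k ^ 3))%N.
  rewrite mulnDr leq_add ?leq_mul2l ?Bk ?orbT //.
  apply: (@leq_trans (N * (T * (T * B)))%N).
    rewrite (_ : P * (T * B * (T * B)) = (P * B) * (T * (T * B)))%N; last by lia.
    by rewrite leq_mul2r PBN orbT.
  rewrite leq_mul2l; apply/orP; right.
  by rewrite !expnS expn0 muln1 !leq_mul.
apply: leq_trans (_ : 2 * (N * (k + k ^ 3)) ^ N./2 <= _)%N.
  by rewrite leq_mul2l leq_exp2r ?step //; lia.
rewrite -(ler_nat R) -ler_ln ?posrE ?ltr0n ?fact_gt0 //; last first.
  by rewrite muln_gt0 expn_gt0 muln_gt0 N0 addn_gt0 (leq_trans _ k20).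
apply: le_trans (ln_fact R N).
have c0 : 0 < (k%:R + k%:R ^+ 3 : R).
  by rewrite addr_gt0 ?exprn_gt0 ?ltr0n ?(leq_trans _ k20).
have N0R : 0 < (N%:R : R) by rewrite ltr0n.
rewrite natrM natrX natrM natrD natrX.
rewrite lnM ?posrE ?exprn_gt0 ?mulr_gt0 // lnXn ?mulr_gt0 // lnM ?posrE //.
have h1 : ln (64 * (k%:R + k%:R ^+ 3)) <= ln N%:R :> R.
  rewrite ler_ln ?posrE ?mulr_gt0 //; apply: le_trans (cubic_le_exp2 k20) _.
  by rewrite -natrX ler_nat.
have E64 : ln (64 : R) = 6 * ln 2.
  by rewrite mulr_natl -lnXn //; congr ln; lra.
rewrite lnM ?posrE // E64 in h1.
have EN : N%:R = 2 * N./2%:R :> R.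
  by rewrite -natrM mul2n -[in LHS](odd_double_half N) (negPf eN).
have h : 1 <= N./2%:R :> R.
  by rewrite ler1n half_gt0; apply: leq_trans N20; rewrite (leq_exp2l 1).
rewrite -[_ *+ N./2]mulr_natl; move: h1.
move: (ln N%:R) (ln (k%:R + _)) => x y h1.
have : 0 <= N./2%:R * (x - 6 * ln 2 - y) by rewrite mulr_ge0 //; lra.
have : 0 <= (N./2%:R - 1) * (6 * ln 2 - 2) :> R by rewrite mulr_ge0 //; lra.
rewrite EN; lra.
Qed.

End FewFastBlind.

(** * Randomized algorithms *)

Section Randomized.
Variable R : realType.

Section AlmostSurely.
Variables (T : Type) (A : randomized R T).

Lemma almost_surelyW (Q1 Q2 : T -> Prop) :
  (forall D, Q1 D -> Q2 D) -> almost_surely A Q1 -> almost_surely A Q2.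
Proof. by move=> h; apply: filterS => w; exact: h. Qed.

Lemma almost_surelyI (Q1 Q2 : T -> Prop) :
  almost_surely A Q1 -> almost_surely A Q2 ->
  almost_surely A (fun D => Q1 D /\ Q2 D).
Proof. exact: filterI. Qed.

Lemma almost_surely_forall (I : finType) (Q : I -> T -> Prop) :
  (forall i, almost_surely A (Q i)) ->
  almost_surely A (fun D => forall i, Q i D).
Proof. exact: filter_forall. Qed.

End AlmostSurely.

Lemma expected_ge (T : Type) (A : randomized R T) (cost : T -> nat) (x : R) :
  0 <= x -> cost_measurable A cost ->
  almost_surely A (fun D => x <= (cost D)%:R) -> (x%:E <= expected A cost)%E.
Proof.
move=> x0 mc cx; rewrite /expected unlock.
have -> : (x%:E = \int[seed_prob A]_w (cst x%:E w))%E.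
  by rewrite integral_cst // [X in (_ * X)%E]probability_setT mule1.
apply: ae_ge0_le_integral => //.
  exact/measurable_realfun.measurable_EFinP.
have imp (w : seed A) : x <= (cost (choice_of w))%:R ->
    [set: seed A]%classic w -> (cst x%:E w <= (cost (choice_of w))%:R%:E)%E.
  by move=> wx _; rewrite lee_fin.
exact: filterS imp cx.
Qed.

Lemma expected_sum (T : Type) (A : randomized R T) (I : finType)
    (cost : I -> T -> nat) :
  (forall i, cost_measurable A (cost i)) ->
  (expected A (fun D => \sum_i cost i D)%N = \sum_i expected A (cost i))%E.
Proof.
move=> mc; rewrite /expected unlock -ge0_integral_sum //.
- by apply: eq_integral => w _; rewrite natr_sum sumEFin.
- by move=> i; apply/measurable_realfun.measurable_EFinP; exact: mc.
Qed.

Lemma cost_measurable_sum (T : Type) (A : randomized R T) (I : finType)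
    (cost : I -> T -> nat) :
  (forall i, cost_measurable A (cost i)) ->
  cost_measurable A (fun D => \sum_i cost i D)%N.
Proof.
move=> mc; rewrite /cost_measurable.
under eq_fun => w do rewrite natr_sum.
exact: (measurable_sum (index_enum I) mc).
Qed.

(** Averaging in the manner of Yao: if almost every deterministic algorithm is slow on average over
    [I], linearity of expectation provides an instance that is slow in expectation. *)
Lemma expected_sum_ge (T : Type) (A : randomized R T) (I : finType)
    (cost : I -> T -> nat) (x y : R) :
  0 <= y -> y < x -> (0 < #|I|)%N -> (forall i, cost_measurable A (cost i)) ->
  almost_surely A (fun D => #|I|%:R * x <= (\sum_i cost i D)%N%:R) ->
  exists i, (y%:E <= expected A (cost i))%E.
Proof.
move=> y0 yx I0 mc cx; apply: contrapT => /forallNP small.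
have : ((#|I|%:R * x)%:E <= \sum_(i : I) y%:E)%E.
  apply: (@le_trans _ _ (expected A (fun D => \sum_i cost i D)%N)).
    apply: expected_ge => //; last exact: cost_measurable_sum.
    by rewrite mulr_ge0 // (le_trans y0) // ltW.
  rewrite expected_sum //; apply: lee_sum => i _.
  by apply/ltW; rewrite ltNge; apply/negP; exact: small.
rewrite sumEFin lee_fin sumr_const -[leRHS]mulr_natl ler_pM2l ?ltr0n //.
by rewrite leNgt yx.
Qed.

Lemma blind_log_bound (N M B P : nat)
    (A : randomized R (labeling N -> program void P M B)) :
  (2 ^ 20 <= N)%N -> ~~ odd N -> (0 < B)%N -> (0 < P)%N -> (P * B <= N)%N ->
  N%:R / P%:R <= log2 P%:R :> R ->
  almost_surely A (@blind P M B N) ->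
  (forall l : labeling N, cost_measurable A (fun D => size (D l))) ->
  (forall l : labeling N, almost_surely A (fun D => solves_proximate l (D l))) ->
  exists l : labeling N, ((log2 P%:R / 4)%:E <= expected A (fun D => size (D l)))%E.
Proof.
move=> N20 eN B0 P0 PBN NP Ablind Am Asol.
have [L LP] := choice (fun pi => labeling_of_perm pi eN).
have lg0 := log2_ge0 R P0.
have /andP[T1 T2] := truncn_itv lg0.
set T := Num.truncn (log2 P%:R) in T1 T2.
suff [pi piP] : exists pi : {perm 'I_N},
    ((log2 P%:R / 4)%:E <= expected A (fun D => size (D (L pi))))%E.
  by exists (L pi).
(* At least half of the permutations need T.+1 rounds or more, so the average is at least T.+1 /
   2. *)
apply: (@expected_sum_ge _ A _ (fun pi D => size (D (L pi))) (T.+1%:R / 2)).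
- by rewrite divr_ge0.
- by lra.
- by rewrite card_Sn fact_gt0.
- by move=> pi; exact: Am.
have sol : almost_surely A (fun D => forall pi, solves_proximate (L pi) (D (L pi))).
  by apply: almost_surely_forall => pi; exact: Asol.
apply: almost_surelyW (almost_surelyI Ablind sol) => D [Db Ds].
pose F : {set {perm 'I_N}} := [set pi | (size (D (L pi)) <= T)%N].
have F2 : (2 * #|F| <= N`!)%N.
  apply: leq_trans (few_blind_solved N20 eN B0 P0 PBN NP T1).
  rewrite leq_mul2l /=; apply: (card_blind_solved B0 Db LP) => pi.
  by rewrite inE.
have FC : (#|F| + #|~: F| = N`!)%N by rewrite cardsC card_Sn.
have h : (#|~: F| * T.+1 <= \sum_pi size (D (L pi)))%N.
  rewrite -sum_nat_const big_mkcond; apply: leq_sum => pi _.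
  by rewrite !inE -ltnNge; case: ltnP.
rewrite card_Sn mulrA ler_pdivrMr // -!natrM ler_nat.
apply: leq_trans (leq_mul h (leqnn 2)).
rewrite mulnAC leq_mul2r; apply/orP; right.
by rewrite -FC; move: F2; rewrite -FC; lia.
Qed.

End Randomized.

Theorem theorem4 (R : realType) :
  exists c : R, 0 < c /\
  exists N0 : nat, forall N M B P : nat,
    (N0 <= N)%N -> (0 < B)%N -> (0 < P)%N -> (P * B <= N)%N ->
    [/\ (* proximate neighbors, algorithms tailored to the labeling *)
        ~~ odd N -> (B < N)%N ->
        exists l : labeling N,
        forall A : randomized R (program void P M B),
          cost_measurable A size ->
          almost_surely A (solves_proximate l) ->
          ((c * (perm_bound R P N M B
                 + Num.min (N%:R / P%:R) (log2 P%:R)))%:E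
             <= expected A size)%E,
        (* proximate neighbors, algorithms not knowing the labeling *)
        ~~ odd N -> (B < N)%N ->
        forall A : randomized R (labeling N -> program void P M B),
          almost_surely A (@blind P M B N) ->
          (forall l : labeling N, cost_measurable A (fun D => size (D l))) ->
          (forall l : labeling N,
             almost_surely A (fun D => solves_proximate l (D l))) ->
          exists l : labeling N,
            ((c * (perm_bound R P N M B + log2 P%:R))%:E
               <= expected A (fun D => size (D l)))%E,
        (* semigroup evaluation *)
        exists pi : {perm 'I_N},
        forall A : randomized R (program (semigroup_op M) P M B),
          cost_measurable A size ->
          (forall (S : semigroupType) (x : 'I_N -> S),
             almost_surely A (solves_semigroup pi x)) ->
          ((c * (perm_bound R P N M B + log2 P%:R))%:E
             <= expected A size)%E
      & (* atomic edge contraction *)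
        exists sigma : {perm 'I_N},
        forall A : randomized R (program (edge_op M) P M B),
          cost_measurable A size ->
          almost_surely A (solves_edges sigma) ->
          ((c * (perm_bound R P N M B + log2 P%:R))%:E
             <= expected A size)%E].
Proof.
have c0 := hard_const_gt0 R.
have c1 : hard_const R <= 1.
  rewrite /hard_const invf_le1 ?mulr_gt0 ?expR_gt0 //.
  have : 1 <= expR (16 : R) by rewrite -expR0 ler_expR.
  lra.
(* The 8 comes from the blind case: log2 P / 4 has to pay for two terms, each at most log2 P. *)
exists (hard_const R / 8); split; first by rewrite divr_gt0.
exists (2 ^ 20)%N => N M B P N20 B0 P0 PBN.
have N1 : (1 < N)%N by apply: leq_trans N20; rewrite (ltn_exp2l 0).
have perm0 : 0 <= perm_bound R P N M B by exact: perm_bound_ge0.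
have minperm : Num.min (N%:R / P%:R) (log2 P%:R) <= perm_bound R P N M B.
  exact: min_log2_le_perm_bound.
have lg0 := log2_ge0 R P0.
set pb := perm_bound R P N M B in perm0 minperm *.
have min0 : 0 <= Num.min (N%:R / P%:R) (log2 P%:R) :> R.
  by rewrite le_min lg0 andbT divr_ge0.
have c8 : 0 <= hard_const R / 8 by rewrite divr_ge0 // ltW.
have cpb0 : 0 <= hard_const R * pb by rewrite mulr_ge0 // ltW.
have clg0 : 0 <= hard_const R * log2 P%:R by rewrite mulr_ge0 // ltW.
have clg : hard_const R * log2 P%:R <= log2 P%:R by rewrite ler_piMl.
split.
- move=> eN BN; have [pi piP] := hard_proximate R M B0 P0 PBN BN.
  have [l lP] := labeling_of_perm pi eN.
  exists l => A Am Asol; apply: expected_ge => //.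
    by rewrite mulr_ge0 // addr_ge0.
  apply: almost_surelyW Asol => D /(proximate_schedule B0 lP)/piP; apply: le_trans.
  have := ler_wpM2l (ltW c0) minperm; rewrite -/pb mulrDr; lra.
- move=> eN BN A Ablind Am Asol.
  (* If N/P <= log2 P, then [perm_bound] is at most log2 P and the blind bound covers both terms;
     otherwise log2 P is at most [perm_bound]. *)
  have [NP|NP] := leP (N%:R / P%:R : R) (log2 P%:R).
    have [l lP] := blind_log_bound N20 eN B0 P0 PBN NP Ablind Am Asol.
    exists l; apply: le_trans lP; rewrite lee_fin.
    have : pb <= log2 P%:R by apply: le_trans NP; rewrite /pb /perm_bound ge_min lexx.
    move/(ler_wpM2l (ltW c0)); lra.
  have [pi piP] := hard_proximate R M B0 P0 PBN BN.
  have [l lP] := labeling_of_perm pi eN.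
  exists l; apply: expected_ge; first by rewrite mulr_ge0 // addr_ge0.
    exact: Am.
  apply: almost_surelyW (Asol l) => D /(proximate_schedule B0 lP)/piP; apply: le_trans.
  move: minperm; rewrite (min_idPr (ltW NP)) => /(ler_wpM2l (ltW c0)).
  rewrite -/pb; lra.
- have [pi piP] := hard_gather R M B0 P0 PBN N1.
  exists pi => A Am Asol; apply: expected_ge => //.
    by rewrite mulr_ge0 // addr_ge0.
  apply: almost_surelyW (Asol (word N) (fun i => [:: i])) => D.
  move=> /(semigroup_gathers B0)/piP[h1 h2].
  rewrite -/pb in h1; lra.
have [pi piP] := hard_gather R M B0 P0 PBN N1.
exists (pi^-1)%g => A Am Asol; apply: expected_ge => //.
  by rewrite mulr_ge0 // addr_ge0.
apply: almost_surelyW Asol => D /(edges_gather B0)/piP[h1 h2].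
rewrite -/pb in h1; lra.
Qed.
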